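(* Let $n\ge1$ and let $x=(x_1,\dots,x_n)$, $y=(y_1,\dots,y_n)$ be indeterminates. Then \begin{align*} A^{(2)}_{\mathrm{VH}}(4n+1;x,y;\zeta_4)&=2^{-2n^2}\prod_{i=1}^n x_i^{-2n}y_i^{-2n}\prod_{i,j=1}^n(x_i^2+y_j^2)(1+x_i^2y_j^2),\\ A^{(2)}_{\mathrm{VH}}(4n+1;x,y;\zeta_6)&=\frac{3^{-n^2}}{\prod_{i=1}^n(x_i+x_i^{-1})(y_i+y_i^{-1})}\,\tilde{\mathrm O}_{4n}\big(\delta(n+\tfrac12,n-\tfrac12);x_1^2,\dots,x_n^2,y_1^2,\dots,y_n^2\big),\\ A^{(2)}_{\mathrm{VH}}(4n+1;x,x;\zeta_8)&=\frac{2^{-n(n-1)}}{\prod_{i=1}^n(x_i+x_i^{-1})^2}\,\tilde{\mathrm O}_{2n}\big(\delta^2(n+\tfrac12,n-\tfrac32);x_1^2,\dots,x_n^2\big)\,\tilde{\mathrm O}_{2n}\big(\delta^2(n-\tfrac12,n-\tfrac12);x_1^2,\dots,x_n^2\big). \end{align*}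
   Context: $\sigma(t)=t-t^{-1}$, $\zeta_m=\exp(2\pi\sqrt{-1}/m)$. For parameters $a,b,c$ let $M_{\mathrm{UU}}(n;x,y;a,b,c)$ be the $n\times n$ matrix with entries $\dfrac{\sigma(b/y_j)\sigma(cx_i)}{\sigma(ax_i/y_j)}-\dfrac{\sigma(b/y_j)\sigma(c/x_i)}{\sigma(a/(x_iy_j))}-\dfrac{\sigma(by_j)\sigma(cx_i)}{\sigma(ax_iy_j)}+\dfrac{\sigma(by_j)\sigma(c/x_i)}{\sigma(ay_j/x_i)}$, let $F_{\mathrm V}(n;x,y;a)=\dfrac{\prod_{i,j=1}^n\sigma(ax_i/y_j)\sigma(ay_j/x_i)\sigma(ax_iy_j)\sigma(a/(x_iy_j))}{\prod_{1\le i<j\le n}\sigma(x_j/x_i)\sigma(y_i/y_j)\prod_{1\le i\le j\le n}\sigma(1/(x_ix_j))\sigma(y_iy_j)}$, and $A^{(2)}_{\mathrm{VH}}(4n+1;x,y;a)=\sigma(a)^{-2n^2-n}F_{\mathrm V}(n;x,y;a)\det M_{\mathrm{UU}}(n;x,y;a,a,a)$; with $y=x$ for the last identity. Sequences: for $r\in\mathbb Z+\tfrac12$, $\delta(r)=(r,r-1,\dots)$ consists of all $r-k\ge0$ ($k\in\mathbb Z_{\ge0}$), $\delta^2(r)=(r,r-2,r-4,\dots)$ of all $r-2k\ge0$; both are empty if $r<0$. $\delta(r,s)$ (resp. $\delta^2(r,s)$) arranges the entries of $\delta(r),\delta(s)$ (resp. $\delta^2(r),\delta^2(s)$) together in non-increasing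 order. As the index of a character in $N$ variables, such a sequence is replaced by its first $N$ entries. For a half-partition $\lambda=(\lambda_1\ge\dots\ge\lambda_N>0)$, $\lambda_i\in\mathbb Z+\frac12$, and $z=(z_1,\dots,z_N)$: $\tilde{\mathrm O}_{2N}(\lambda;z)=\det\big(z_i^{\lambda_j+N-j}+z_i^{-(\lambda_j+N-j)}\big)\big/\big(\tfrac12\det\big(z_i^{N-j}+z_i^{-(N-j)}\big)\big)$. Here $z_i=w_i^2$ for indeterminates $w_i$ and $z_i^r$ for half-integer $r$ means $w_i^{2r}$. *)

(* Defs.v *)
From mathcomp Require Import all_boot all_order all_algebra.
From mathcomp Require Import fraction complex mpoly.
From mathcomp Require Import reals trigo.

Set Implicit Arguments.
Unset Strict Implicit.
Unset Printing Implicit Defensive.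

Import Order.TTheory GRing.Theory Num.Theory.
Local Open Scope ring_scope.
Local Open Scope complex_scope.

(* exp(2 pi sqrt(-1) / m), with exp(sqrt(-1) t) = cos t + sqrt(-1) sin t. *)
Definition zeta (R : realType) (m : nat) : R[i] :=
  let t := 2 * pi / m%:R in cos t +i* sin t.

(* The indeterminates x_1, ..., x_n, y_1, ..., y_n live in the field of
   rational functions in n + n variables over C: the first n variables are
   the x_i, the last n ones are the y_j. *)
Notation ratfun R n := {fraction {mpoly R[i][n + n]}}.

Definition cst (R : realType) (n : nat) (c : R[i]) : ratfun R n :=
  tofrac (c%:MP_[n + n]).

Definition xvar (R : realType) (n : nat) : 'rV[ratfun R n]_n :=
  \row_i tofrac 'X_(lshift n i).

Definition yvar (R : realType) (n : nat) : 'rV[ratfun R n]_n :=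
  \row_i tofrac 'X_(rshift n i).

Section Functions.
Variable K : fieldType.

Definition sigma (t : K) : K := t - t^-1.

Definition MUU (n : nat) (x y : 'rV[K]_n) (a b c : K) : 'M[K]_n :=
  \matrix_(i, j)
    (let xi := x 0 i in let yj := y 0 j in
       sigma (b / yj) * sigma (c * xi) / sigma (a * xi / yj)
     - sigma (b / yj) * sigma (c / xi) / sigma (a / (xi * yj))
     - sigma (b * yj) * sigma (c * xi) / sigma (a * xi * yj)
     + sigma (b * yj) * sigma (c / xi) / sigma (a * yj / xi)).

Definition FV (n : nat) (x y : 'rV[K]_n) (a : K) : K :=
  (\prod_(i < n) \prod_(j < n)
     (sigma (a * x 0 i / y 0 j) * sigma (a * y 0 j / x 0 i)
      * sigma (a * x 0 i * y 0 j) * sigma (a / (x 0 i * y 0 j))))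
  / ((\prod_(i < n) \prod_(j < n | (i < j)%N)
        (sigma (x 0 j / x 0 i) * sigma (y 0 i / y 0 j)))
     * (\prod_(i < n) \prod_(j < n | (i <= j)%N)
          (sigma (1 / (x 0 i * x 0 j)) * sigma (y 0 i * y 0 j)))).

Definition AVH2 (n : nat) (x y : 'rV[K]_n) (a : K) : K :=
  sigma a ^- (2 * n ^ 2 + n) * FV x y a * \det (MUU x y a a a).

(* z^r for z = w^2 and r in (1/2)Z, that is w^(2r). *)
Definition halfpow (w : K) (r : rat) : K := w ^ Num.floor (2 * r).

(* \tilde O_{2N}(lambda; w_1^2, ..., w_N^2). As lambda is indexed from 0 here,
   the exponent lambda_j + N - j of the usual formula is
   lambda j + (N - j.+1). *)
Definition Otilde (N : nat) (lambda : 'I_N -> rat) (w : 'rV[K]_N) : K :=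
  let alt (e : 'I_N -> rat) : 'M[K]_N :=
    \matrix_(i, j) (halfpow (w 0 i) (e j) + halfpow (w 0 i) (- e j)) in
  \det (alt (fun j => lambda j + (N - j.+1)%:R))
  / (2^-1 * \det (alt (fun j => (N - j.+1)%:R))).

End Functions.

(* All the r - s * k >= 0 with k a natural number, for s > 0. Such a k is at
   most r, hence the range of k. *)
Definition descending (s : nat) (r : rat) : seq rat :=
  [seq t <- [seq r - (s * k)%:R | k <- iota 0 (Num.truncn r).+1] | 0 <= t].

Definition merge_desc (s t : seq rat) : seq rat :=
  sort (fun u v => v <= u) (s ++ t).

Definition delta (r s : rat) : seq rat :=
  merge_desc (descending 1 r) (descending 1 s).

Definition delta2 (r s : rat) : seq rat :=
  merge_desc (descending 2 r) (descending 2 s).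

(* The default value 0 is never reached for the sequences and the N in use. *)
Definition first_entries (N : nat) (s : seq rat) (j : 'I_N) : rat :=
  nth 0 s j.
Arguments first_entries : clear implicits.

(* Main.v *)
Require Import Defs.
From mathcomp Require Import all_boot all_order all_algebra.
From mathcomp Require Import fraction complex mpoly.
From mathcomp Require Import reals trigo.
From mathcomp Require Import perm ring lra zify.

(* Put X = x^2 + x^-2, Y = y^2 + y^-2 and A = a^2 + a^-2.  For a = b = c the entry
   of M_UU is sigma(a) sigma(x^2) sigma(y^2) (X + Y - A - 2) / D, where D is the
   product A^2 - A X Y + X^2 + Y^2 - 4 of the four sigmas occurring in F_V, so that
   A_VH is (2 - A)^(-n^2) times
     \prod D * \det ((X + Y - A - 2) / D) / (V(X) V(Y)),  V = Vandermonde.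
   At zeta_4, zeta_6, zeta_8 we have A = -2, -1, 0, and with
   c_s(w) = w^s + w^-s the denominator D is respectively (X + Y)^2,
   (c_6(x) - c_6(y)) / (X - Y) and c_4(x) + c_4(y).  The matrix entry becomes
   1 / (X + Y), resp. (f(x) - f(y)) / (c_6(x) - c_6(y)) with f = c_5 / c_1, resp.
   (g(x) + g(y)) / (c_4(x) + c_4(y)) with g = c_3 / c_1.  These generalised Cauchy
   determinants are Vandermonde-like determinants of twice the size, with columns
   c_6^k, f c_6^k in the second case; in the third case the matrix of size 2n
   splits by parity into two of size n.  After multiplication of the rows by c_1,
   a unitriangular change of columns produces the columns c_s, with s the exponents
   in the numerators of the orthogonal characters. *)

Set Implicit Arguments.
Unset Strict Implicit.
Unset Printing Implicit Defensive.

Import Order.TTheory GRing.Theory Num.Theory.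
Local Open Scope ring_scope.

(** * Vandermonde products and Lagrange interpolation *)

Section Interpolation.
Variable K : fieldType.

Definition vprod n (x : 'rV[K]_n) : K :=
  \prod_(i < n) \prod_(j < n | (i < j)%N) (x 0 j - x 0 i).

Definition vdm n (x : 'rV[K]_n) : 'M[K]_n := \matrix_(i, j) x 0 i ^+ j.

Lemma det_vdm n (x : 'rV[K]_n) : \det (vdm x) = vprod x.
Proof.
rewrite /vprod -det_Vandermonde -det_tr; congr (\det _).
by apply/matrixP => i j; rewrite !mxE.
Qed.

Lemma vprod_neq0 n (x : 'rV[K]_n) :
  (forall i j, i != j -> x 0 i != x 0 j) -> vprod x != 0.
Proof.
move=> x_inj; apply/prodf_neq0 => i _; apply/prodf_neq0 => j lt_ij.
by rewrite subr_eq0 x_inj // -val_eqE /= gtn_eqF.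
Qed.

(** Each pair i < j contributes a factor -1. Grouping the pairs by the larger index [j] gives the
    sign as a product over [j], the form in which it meets the other signs below. *)
Lemma vprodN n (x : 'rV[K]_n) :
  vprod (- x) = (\prod_(j < n) (-1) ^+ j) * vprod x.
Proof.
have -> : \prod_(j < n) (-1) ^+ j =
          \prod_(i < n) \prod_(j < n | (i < j)%N) (-1) :> K.
  rewrite (exchange_big_dep xpredT) //=; apply: eq_bigr => j _.
  rewrite -(big_mkord (fun i => i < j)%N (fun=> -1)).
  rewrite (big_cat_nat (leq0n j) (ltnW (ltn_ord j))) /=.
  rewrite [X in _ * X]big_nat_cond [X in _ * X]big1 => [|i]; last lia.
  rewrite mulr1 big_nat_cond (eq_bigl (fun i => (0 <= i < j)%N && true)).
    by rewrite -big_nat_cond prodr_const_nat subn0.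
  by move=> i; rewrite andbT leq0n andbb.
rewrite /vprod -big_split; apply: eq_bigr => i _; rewrite -big_split /=.
by apply: eq_bigr => j _; rewrite !mxE mulN1r opprB opprK addrC.
Qed.

Lemma prod_ordered_pairs n (F : 'I_n -> 'I_n -> K) :
  \prod_(i < n) \prod_(j < n | j != i) F i j
  = \prod_(i < n) \prod_(j < n | (i < j)%N) (F i j * F j i).
Proof.
under [RHS]eq_bigr do rewrite big_split /=.
rewrite big_split /= [X in _ = _ * X](exchange_big_dep xpredT) //= -big_split /=.
apply: eq_bigr => i _; rewrite (bigID (fun j : 'I_n => (i < j)%N)) /=.
congr (_ * _); apply: eq_bigl => j; rewrite -val_eqE /=; lia.
Qed.

Definition lagr n (x : 'rV[K]_n) (t : K) (i : 'I_n) : K :=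
  \prod_(k < n | k != i) ((t - x 0 k) / (x 0 i - x 0 k)).

(** The difference [p] of X^m and its interpolation polynomial has degree less than n and vanishes
    at the n distinct nodes, hence is zero. *)
Lemma lagrange_pow n (x : 'rV[K]_n) (t : K) (m : nat) :
  (forall i j, i != j -> x 0 i != x 0 j) -> (m < n)%N ->
  \sum_(i < n) lagr x t i * x 0 i ^+ m = t ^+ m.
Proof.
move=> x_inj lt_mn.
pose L i : {poly K} := \prod_(k < n | k != i) ('X - (x 0 k)%:P).
pose p : {poly K} :=
  'X^m - \sum_(i < n) (x 0 i ^+ m / (L i).[x 0 i]) *: L i.
have LE i s : (L i).[s] = \prod_(k < n | k != i) (s - x 0 k).
  by rewrite horner_prod; apply: eq_bigr => k _; rewrite !hornerE.
have L_neq0 i : (L i).[x 0 i] != 0.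
  rewrite LE; apply/prodf_neq0 => k ki.
  by rewrite subr_eq0 x_inj // eq_sym.
have Lvan i j : j != i -> (L i).[x 0 j] = 0.
  by move=> ji; rewrite LE (bigD1 j) //= subrr mul0r.
have pt : p.[t] = t ^+ m - \sum_(i < n) lagr x t i * x 0 i ^+ m.
  rewrite !hornerE horner_sum; congr (_ - _); apply: eq_bigr => i _.
  by rewrite !hornerE /lagr big_split /= -LE prodfV -LE mulrAC (mulrC (x 0 i ^+ m)) mulrAC.
suff -> : \sum_(i < n) lagr x t i * x 0 i ^+ m = t ^+ m - p.[t].
  rewrite (_ : p = 0) ?horner0 ?subr0 //; apply/eqP/contraT => p_neq0.
  have /(max_poly_roots p_neq0) : all (root p) [seq x 0 i | i <- enum 'I_n].
    apply/allP => _ /mapP [j _ ->]; rewrite rootE !hornerE horner_sum.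
    rewrite (bigD1 j) //= big1 ?addr0 => [|i ij]; rewrite !hornerE.
      by rewrite divfK // subrr.
    by rewrite [X in _ * X]Lvan ?mulr0 // eq_sym.
  rewrite map_inj_in_uniq ?enum_uniq; last first.
    by move=> i j _ _ xij; apply: contra_eq xij; exact: x_inj.
  move=> /(_ isT); rewrite size_map size_enum_ord ltnNge => /negP [].
  rewrite (leq_trans (size_polyD _ _)) // geq_max size_polyXn lt_mn size_polyN.
  apply: (leq_trans (size_sum _ _ _)); apply/bigmax_leqP => i _.
  apply: (leq_trans (size_scale_leq _ _)).
  rewrite /L -big_filter size_prod_XsubC size_filter.
  have := cardC1 i; rewrite card_ord cardE /enum_mem size_filter => ->.
  by rewrite prednK // (leq_ltn_trans _ lt_mn).
by rewrite pt; ring.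
Qed.

End Interpolation.

(** * Block Vandermonde determinants and generalised Cauchy determinants *)

Section BlockVandermonde.
Variable K : fieldType.
Implicit Types n : nat.

Definition vblk n (x y a b : 'rV[K]_n) : 'M[K]_(n + n) :=
  block_mx (vdm x) (diag_mx a *m vdm x) (vdm y) (diag_mx b *m vdm y).

(** A Löwner matrix: if [a] and [b] are the values of one function at the nodes [x] and [y], the
    entries are its divided differences. For a = 0 and b = 1 it is a Cauchy matrix. *)
Definition cauchyM n (x y a b : 'rV[K]_n) : 'M[K]_n :=
  \matrix_(i, j) ((b 0 j - a 0 i) / (y 0 j - x 0 i)).

(** This is the discriminant up to sign: the two orders of each pair give V(x) V(-x). *)
Lemma prod_diff n (x : 'rV[K]_n) :
  \prod_(i < n) \prod_(k < n | k != i) (x 0 i - x 0 k)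
  = (\prod_(j < n) (-1) ^+ j) * vprod x ^+ 2.
Proof.
rewrite prod_ordered_pairs expr2 mulrA -vprodN /vprod -big_split /=.
apply: eq_bigr => i _; rewrite -big_split; apply: eq_bigr => j _ /=.
by rewrite !mxE opprK [- _ + _]addrC.
Qed.

Lemma prod_signs_sqr n : (\prod_(j < n) (-1) ^+ j) ^+ 2 = 1 :> K.
Proof.
by rewrite -prodrXl big1 // => j _; rewrite -exprM mulnC exprM sqrrN !expr1n.
Qed.

(* With T the matrix of Lagrange interpolation from the nodes x to the nodes y,
   so that T V(x) = V(y), block elimination leaves the Schur complement
   (diag(b) T - T diag(a)) V(x), and the entries of T are
   \prod_k (y_j - x_k) / ((y_j - x_i) \prod_(k != i) (x_i - x_k)). *)
Lemma det_vblk n (x y a b : 'rV[K]_n) :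
    (forall i j, i != j -> x 0 i != x 0 j) ->
    (forall i j, y 0 j != x 0 i) ->
  \det (vblk x y a b)
  = (\prod_(j < n) (-1) ^+ j) * (\prod_(i < n) \prod_(j < n) (y 0 j - x 0 i))
    * \det (cauchyM x y a b).
Proof.
move=> x_inj xy.
pose T : 'M[K]_n := \matrix_(j, i) lagr x (y 0 j) i.
have TV : T *m vdm x = vdm y.
  apply/matrixP => j k; rewrite !mxE -[RHS](lagrange_pow _ x_inj (ltn_ord k)).
  by apply: eq_bigr => i _; rewrite !mxE.
have -> : vblk x y a b = block_mx 1%:M 0 T 1%:M *m
    block_mx (vdm x) (diag_mx a *m vdm x) 0
             ((diag_mx b *m T - T *m diag_mx a) *m vdm x).
  rewrite mulmx_block !mul1mx !mul0mx !addr0 TV mulmxBl -!mulmxA TV.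
  by rewrite addrC subrK.
rewrite det_mulmx det_lblock !det1 !mul1r det_ublock det_mulmx !det_vdm.
pose P (t : K) := \prod_(k < n) (t - x 0 k).
pose p' i := \prod_(k < n | k != i) (x 0 i - x 0 k).
have -> : diag_mx b *m T - T *m diag_mx a =
    diag_mx (\row_j P (y 0 j)) *m (cauchyM x y a b)^T *m diag_mx (\row_i (p' i)^-1).
  rewrite !mul_mx_diag !mul_diag_mx; apply/matrixP => j i.
  rewrite !mxE /lagr big_split /= prodfV -/(p' i).
  rewrite [P _](bigD1 i) //=; have := xy i j; rewrite -subr_eq0 => yx.
  by move: (p' i)^-1 => q; field.
rewrite !det_mulmx !det_diag det_tr.
under [X in _ * (X * _ * _ * _)]eq_bigr do rewrite mxE.
under [X in _ * (_ * X * _)]eq_bigr do rewrite mxE.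
rewrite prodfV /p' prod_diff [X in _ * (X * _ * _ * _)]exchange_big /=.
have := vprod_neq0 x_inj; have := prod_signs_sqr n.
set s := \prod_(j < n) _; set v := vprod x => s2 v_neq0.
have s_neq0 : s != 0 by apply: contra_eq_neq s2 => ->; rewrite expr0n eq_sym oner_eq0.
(* The factor V(x)^2 / (s V(x)^2) leaves 1/s, which equals s because s^2 = 1. *)
by rewrite -[s in RHS]divr1 -s2; field; rewrite s_neq0.
Qed.

(** The case of nodes -x and y with weights 0 and 1 in [det_vblk]: the block matrix is then lower
    triangular, with determinant V(-x) V(y). *)
Lemma det_cauchy n (x y : 'rV[K]_n) :
    (forall i j, i != j -> x 0 i != x 0 j) ->
    (forall i j, x 0 i + y 0 j != 0) ->
  (\prod_(i < n) \prod_(j < n) (x 0 i + y 0 j))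
    * \det (\matrix_(i, j) (x 0 i + y 0 j)^-1 : 'M[K]_n) = vprod x * vprod y.
Proof.
move=> x_inj xy.
have Nx_inj i j : i != j -> (- x) 0 i != (- x) 0 j.
  by move=> ij; rewrite !mxE eqr_opp x_inj.
have yNx i j : y 0 j != (- x) 0 i by rewrite mxE -addr_eq0 addrC.
have := det_vblk 0 (const_mx 1) Nx_inj yNx.
have -> : vblk (- x) y 0 (const_mx 1) = block_mx (vdm (- x)) 0 (vdm y) (vdm y).
  by rewrite /vblk [diag_mx 0]linear0 mul0mx diag_const_mx mul1mx.
rewrite det_lblock !det_vdm vprodN -!mulrA => e.
have s_neq0 : \prod_(j < n) (-1) ^+ j != 0 :> K.
  by apply/prodf_neq0 => j _; rewrite signr_eq0.
move/(mulfI s_neq0): e => ->; congr (_ * _).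
  by apply: eq_bigr => i _; apply: eq_bigr => j _; rewrite mxE opprK addrC.
by congr (\det _); apply/matrixP => i j; rewrite !mxE opprK subr0 mul1r addrC.
Qed.

Lemma vprod_row_mx n (x y : 'rV[K]_n) :
  vprod (row_mx x y)
  = vprod x * vprod y * \prod_(i < n) \prod_(j < n) (y 0 j - x 0 i).
Proof.
rewrite /vprod big_split_ord /= [in RHS]mulrAC; congr (_ * _).
  rewrite -big_split /=; apply: eq_bigr => i _; rewrite big_split_ord /=; congr (_ * _).
    by apply: eq_bigr => j _; rewrite !row_mxEl.
  apply: eq_big => j; first by rewrite /= ltn_addr.
  by rewrite row_mxEl row_mxEr.
apply: eq_bigr => i _; rewrite big_split_ord /= big_pred0 ?mul1r => [|j].
  apply: eq_big => j; first by rewrite ltn_add2l.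
  by rewrite !row_mxEr.
by rewrite ltnNge (leq_trans (ltnW (ltn_ord j))) ?leq_addr.
Qed.

(** The columns 1, a, x, ax, x^2, ... alternate, so that after the substitutions below their leading
    exponents increase and a unitriangular change of columns applies. *)
Definition interM n N (x a : 'rV[K]_n) : 'M[K]_(n, N) :=
  \matrix_(i, l) (x 0 i ^+ l./2 * (if odd l then a 0 i else 1)).

Lemma interM_vdm n (x a : 'rV[K]_n) :
  interM (n + n) x a
  = vdm x *m (\matrix_(m, l) (l == m.*2 :> nat)%:R)
    + diag_mx a *m vdm x *m (\matrix_(m, l) (l == m.*2.+1 :> nat)%:R).
Proof.
apply/matrixP => i l; rewrite !mxE.
have half_lt : (l./2 < n)%N by have := ltn_ord l; lia.
pose h := Ordinal half_lt.
have h1 (m : 'I_n) : m != h -> (m != l./2 :> nat) by [].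
rewrite (bigD1 h) // [X in _ + X](bigD1 h) //= big1 => [|m /h1 mh]; last first.
  by rewrite !mxE; case: eqP => [?|_]; [lia | rewrite mulr0].
rewrite big1 => [|m /h1 mh]; last first.
  by rewrite !mxE; case: eqP => [?|_]; [lia | rewrite mulr0].
rewrite mul_diag_mx !mxE /= !addr0; case: ifP => l_odd.
  have -> : (l == (l./2).*2 :> nat) = false by lia.
  have -> : (l == (l./2).*2.+1 :> nat) by lia.
  by rewrite mulr0 add0r mulr1 mulrC.
have -> : (l == (l./2).*2 :> nat) by lia.
have -> : (l == (l./2).*2.+1 :> nat) = false by lia.
by rewrite mulr0 addr0.
Qed.

(* The sign of the permutation between the block and the interleaved orders of
   the columns is found by specialising to x = t^2 and a = t, where the
   interleaved matrix is a plain Vandermonde matrix and the right-hand side a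
   Cauchy determinant. *)
Lemma det_interM n (t : 'rV[K]_(n + n)) (x y a b : 'rV[K]_n) :
    (forall i j, i != j -> t 0 i ^+ 2 != t 0 j ^+ 2) ->
    (forall i j, i != j -> x 0 i != x 0 j) ->
    (forall i j, y 0 j != x 0 i) ->
  \det (interM (n + n) (row_mx x y) (row_mx a b))
  = (\prod_(i < n) \prod_(j < n) (y 0 j - x 0 i)) * \det (cauchyM x y a b).
Proof.
pose Q : 'M[K]_(n + n) :=
  col_mx (\matrix_(m, l) (l == m.*2 :> nat)%:R)
         (\matrix_(m, l) (l == m.*2.+1 :> nat)%:R).
have interE (u v c d : 'rV[K]_n) :
    interM (n + n) (row_mx u v) (row_mx c d) = vblk u v c d *m Q.
  rewrite mul_block_col -!interM_vdm; apply/matrixP => i l.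
  by case: (split_ordP i) => k ->; rewrite ?col_mxEu ?col_mxEd [LHS]mxE ?row_mxEl ?row_mxEr [RHS]mxE.
move=> t_inj x_inj xy; rewrite interE det_mulmx det_vblk //.
(* This sign cancels the one in [det_vblk], since the square of the product of signs is 1. *)
suff -> : \det Q = \prod_(j < n) (-1) ^+ j.
  by rewrite mulrC -mulrA [X in X = _]mulrCA mulrA -expr2 prod_signs_sqr mul1r.
pose t1 := lsubmx t; pose t2 := rsubmx t.
pose u : 'rV[K]_n := \row_i t1 0 i ^+ 2; pose v : 'rV[K]_n := \row_i t2 0 i ^+ 2.
have tE : row_mx t1 t2 = t by rewrite hsubmxK.
have t_inj1 i j : i != j -> t 0 i != t 0 j by move/t_inj; apply: contra_neq => ->.
have u_inj i j : i != j -> u 0 i != u 0 j.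
  by move=> ij; rewrite !mxE t_inj // (inj_eq (@lshift_inj _ _)).
have uv i j : v 0 j != u 0 i by rewrite !mxE t_inj // eq_rlshift.
have t1_inj i j : i != j -> t1 0 i != t1 0 j.
  by move=> ij; rewrite !mxE t_inj1 // (inj_eq (@lshift_inj _ _)).
have sq i j : v 0 j - u 0 i = (t2 0 j - t1 0 i) * (t1 0 i + t2 0 j).
  by rewrite !mxE; ring.
have t12 i j : t1 0 i + t2 0 j != 0.
  by have := uv i j; rewrite -subr_eq0 sq mulf_eq0 negb_or => /andP [].
have := interE u v t1 t2; rewrite tE.
have -> : interM (n + n) (row_mx u v) t = vdm t.
  apply/matrixP => i l; rewrite [LHS]mxE [RHS]mxE.
  have -> : t 0 i ^+ l = t 0 i ^+ (odd l + 2 * l./2) by rewrite mul2n odd_double_half.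
  have -> : row_mx u v 0 i = t 0 i ^+ 2.
    by case: (split_ordP i) => k ->; rewrite ?(row_mxEl, row_mxEr) !mxE.
  by rewrite exprD exprM mulrC; case: (odd l).
move/(congr1 determinant); rewrite det_mulmx det_vblk // det_vdm.
rewrite -{1}tE vprod_row_mx.
have -> : cauchyM u v t1 t2 = \matrix_(i, j) (t1 0 i + t2 0 j)^-1.
  apply/matrixP => i j; rewrite [LHS]mxE [RHS]mxE sq invfM mulrA divff ?mul1r //.
  by have := uv i j; rewrite -subr_eq0 sq mulf_eq0 negb_or => /andP [].
under [X in _ * X * _ * _]eq_bigr do under eq_bigr do rewrite sq.
under [X in _ * X * _ * _]eq_bigr do rewrite big_split.
rewrite big_split /= -!mulrA [X in _ = _ * (_ * X)]mulrA det_cauchy //.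
rewrite mulrA mulrCA.
have := prod_signs_sqr n; set s := \prod_(j < n) _.
set z := \prod_(i < n) _ => s2.
have z_neq0 : z != 0.
  apply/prodf_neq0 => i _; apply/prodf_neq0 => j _.
  by have := uv i j; rewrite -subr_eq0 sq mulf_eq0 negb_or => /andP [].
have t2_inj i j : i != j -> t2 0 i != t2 0 j.
  by move=> ij; rewrite !mxE t_inj1 // (inj_eq (@rshift_inj _ _)).
have p_neq0 : vprod t1 * vprod t2 * z != 0 by rewrite !mulf_neq0 ?vprod_neq0.
move=> e; have sQ : s * \det Q = 1.
  by apply: (mulfI p_neq0); rewrite mulr1 [RHS]e; ring.
by rewrite -[LHS]mul1r -s2 expr2 -mulrA sQ mulr1.
Qed.

End BlockVandermonde.

(** * Splitting of a symmetric generalised Cauchy determinant by parity *)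

Section ParitySplitting.
Variable K : fieldType.

(** Under (z, a) -> (-z, -a), the columns 1, az, z^2, az^3, ... of the case [false] are even, and
    the columns a, z, az^2, z^3, ... of the case [true] are odd. *)
Definition parM n (b : bool) (z a : 'rV[K]_n) : 'M[K]_n :=
  \matrix_(i, l) (z 0 i ^+ l * (if odd l (+) b then a 0 i else 1)).

(* The determinant is the case x = -z, y = z, with weights -a and a, of
   det_vblk: adding and subtracting the two row blocks separates the two
   parities of the columns. *)
Lemma det_parM n (z a : 'rV[K]_n) :
    2 != 0 :> K ->
    (forall i j, i != j -> z 0 i != z 0 j) ->
    (forall i j, z 0 i + z 0 j != 0) ->
  (\prod_(i < n) \prod_(j < n) (z 0 i + z 0 j))
    * \det (\matrix_(i, j) ((a 0 i + a 0 j) / (z 0 i + z 0 j)) : 'M[K]_n)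
  = 2 ^+ n * \det (parM false z a) * \det (parM true z a).
Proof.
move=> two_neq0 z_inj zz.
have Nz_inj i j : i != j -> (- z) 0 i != (- z) 0 j.
  by move=> ij; rewrite !mxE eqr_opp z_inj.
have zNz i j : z 0 j != (- z) 0 i by rewrite mxE -addr_eq0.
set s := \prod_(j < n) (-1) ^+ j : K; set rhs := (X in X = _).
have detB : \det (vblk (- z) z (- a) a) = s * rhs.
  rewrite det_vblk // -mulrA; congr (_ * (_ * _)).
    by apply: eq_bigr => i _; apply: eq_bigr => j _; rewrite mxE opprK addrC.
  by congr (\det _); apply/matrixP => i j; rewrite !mxE !opprK addrC [z 0 j + _]addrC.
pose S : 'M[K]_n := diag_mx (\row_j (-1) ^+ j).
pose Pe : 'M[K]_n := diag_mx (\row_j (~~ odd j)%:R).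
pose Po : 'M[K]_n := diag_mx (\row_j (odd j)%:R).
have detS : \det S = s by rewrite det_diag; apply: eq_bigr => j _; rewrite mxE.
(* [Rm] forms the sum and the difference of the row blocks. [G] exchanges the odd-numbered columns
   of the two column blocks, which makes the product block diagonal. *)
pose Rm : 'M[K]_(n + n) := block_mx 1%:M 1%:M (- 1%:M) 1%:M.
pose G : 'M[K]_(n + n) := block_mx Pe Po Po Pe.
have detR : \det Rm = 2 ^+ n.
  have -> : Rm = block_mx 1%:M 0 (- 1%:M) 1%:M *m block_mx 1%:M 1%:M 0 2%:M.
    rewrite mulmx_block !mul1mx !mul0mx !mulNmx !mul1mx !addr0 ?oppr0 ?add0r.
    by congr block_mx; apply/matrixP => i j; rewrite !mxE; case: (i == j); ring.
  by rewrite det_mulmx det_lblock det_ublock !det1 !mul1r det_scalar.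
have detG : \det G = s.
  have eG : block_mx 1%:M 0 1%:M 1%:M *m G *m block_mx 1%:M 0 (- 1%:M) 1%:M
          = block_mx S Po 0 1%:M.
    have PeoE : Pe + Po = 1%:M.
      rewrite -linearD -diag_const_mx; congr diag_mx; apply/rowP => j.
      by rewrite !mxE; case: (odd j); rewrite ?add0r ?addr0.
    have SE : Pe - Po = S.
      rewrite -linearB; congr diag_mx; apply/rowP => j.
      by rewrite !mxE -signr_odd; case: (odd j); rewrite ?expr1 ?expr0 ?sub0r ?subr0.
    rewrite !mulmx_block !mul1mx !mul0mx !mulmx0 !mulmxN !mulmx1 !addr0 !add0r.
    by rewrite [Po + Pe]addrC PeoE SE subrr.
  move/(congr1 determinant): eG.
  by rewrite !det_mulmx !det_lblock det_ublock !det1 !mul1r !mulr1 detS.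
have RBG : Rm *m vblk (- z) z (- a) a *m G
         = block_mx (2 *: parM false z a) 0 0 (2 *: parM true z a).
  rewrite /vblk; have -> : vdm (- z) = vdm z *m S.
    rewrite mul_mx_diag; apply/matrixP => i j; rewrite !mxE.
    by rewrite [LHS]exprNn mulrC.
  rewrite !mulmx_block !mulNmx !mul1mx !mul_mx_diag !mul_diag_mx.
  by congr block_mx; apply/matrixP => i j; rewrite !mxE -[(-1) ^+ j]signr_odd;
     case: (odd j) => /=; rewrite ?expr1 ?expr0 ?mulr0n ?mulr1n; ring.
move/(congr1 determinant): RBG.
rewrite !det_mulmx detR detG detB det_ublock !detZ.
have s2 : s ^+ 2 = 1 := prod_signs_sqr K n.
set E := \det (parM false z a); set O := \det (parM true z a) => e.
apply: (mulfI (expf_neq0 n two_neq0)).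
have -> : 2 ^+ n * rhs = s ^+ 2 * (2 ^+ n * rhs) by rewrite s2 mul1r.
by transitivity (2 ^+ n * E * (2 ^+ n * O)); [rewrite -e|]; ring.
Qed.

End ParitySplitting.

(** * Unitriangular changes of columns *)

Section Unitriangular.
Variables (K : fieldType) (T : Type) (e u : nat -> T -> K).

(** Membership in the span of the first [l] functions [e k]; the coefficients do not depend on the
    point [p], which later indexes a row. *)
Definition lower (l : nat) (v : T -> K) : Prop :=
  exists t : nat -> K, forall p, v p = \sum_(k < l) t k * e k p.

Lemma lowerD l v w : lower l v -> lower l w -> lower l (fun p => v p + w p).
Proof.
move=> [t tE] [t' tE']; exists (fun k => t k + t' k) => p.
by rewrite tE tE' -big_split; apply: eq_bigr => k _; rewrite mulrDl.
Qed.

Lemma lowerZ l c v : lower l v -> lower l (fun p => c * v p).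
Proof.
move=> [t tE]; exists (fun k => c * t k) => p.
by rewrite tE mulr_sumr; apply: eq_bigr => k _; rewrite mulrA.
Qed.

Lemma lower0 l : lower l (fun=> 0).
Proof. by exists (fun=> 0) => p; rewrite big1 // => k _; rewrite mul0r. Qed.

Lemma lower_e l k : (k < l)%N -> lower l (e k).
Proof.
move=> lt_kl; exists (fun m => (m == k)%:R) => p.
rewrite (bigD1 (Ordinal lt_kl)) //= eqxx mul1r big1 ?addr0 // => m.
by rewrite -val_eqE /= => /negPf ->; rewrite mul0r.
Qed.

Lemma lower_ext l v w : (forall p, v p = w p) -> lower l v -> lower l w.
Proof. by move=> vw [t tE]; exists t => p; rewrite -vw. Qed.

Lemma lower_sum l m (t : nat -> K) (v : nat -> T -> K) :
  (forall k, (k < m)%N -> lower l (v k)) ->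
  lower l (fun p => \sum_(k < m) t k * v k p).
Proof.
elim: m => [|m IHm] vl.
  by apply: (lower_ext _ (lower0 l)) => p; rewrite big_ord0.
have /lowerD/(_ (lowerZ (t m) (vl m (leqnn _)))) :=
  IHm (fun k lt_km => vl k (leqW lt_km)).
by apply: lower_ext => p; rewrite big_ord_recr.
Qed.

Lemma lower_leq l m v : (l <= m)%N -> lower l v -> lower m v.
Proof.
move=> le_lm [t tE]; apply: (lower_ext (fun p => esym (tE p))).
by apply: lower_sum => k lt_kl; apply/lower_e/(leq_trans lt_kl).
Qed.

(** Strong induction in steps of [d]: [h * u m] is [h * (u m - e m)] plus [h * e m], and
    multiplication by [h] sends [e k] to [e (k + d)] modulo earlier functions. *)
Lemma lower_rec (d : nat) (h : T -> K) :
    (0 < d)%N ->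
    (forall l, (l < d)%N -> lower l (fun p => u l p - e l p)) ->
    (forall l p, u (l + d)%N p = h p * u l p) ->
    (forall l, lower (l + d) (fun p => h p * e l p - e (l + d)%N p)) ->
  forall l, lower l (fun p => u l p - e l p).
Proof.
move=> d_gt0 u_init u_rec e_rec; elim/ltn_ind => l IHl.
have [/u_init //|le_dl] := ltnP l d.
have [m defl] : exists m, l = (m + d)%N by exists (l - d)%N; rewrite subnK.
have [|t tE] := IHl m; first by lia.
rewrite defl.
have low_he k : (k < m)%N -> lower (m + d) (fun p => h p * e k p).
  move=> lt_km; have lkd : lower (m + d) (e (k + d)%N) by apply: lower_e; lia.
  have := lowerD (lower_leq _ (e_rec k)) lkd.
  by move=> /(_ ltac:(lia)); apply: lower_ext => p; rewrite subrK.
have := lowerD (lower_sum t low_he) (e_rec m).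
apply: lower_ext => p; rewrite u_rec.
have -> : h p * u m p = h p * (u m p - e m p) + h p * e m p by ring.
rewrite tE mulr_sumr -addrA; congr (_ + _).
by apply: eq_bigr => k _; rewrite mulrCA.
Qed.

(** The matrix [L] that expresses the columns [u] by the columns [e] is upper triangular with ones
    on the diagonal. *)
Lemma det_lower N (q : 'I_N -> T) :
    (forall l, lower l (fun p => u l p - e l p)) ->
  \det (\matrix_(i, l) u l (q i) : 'M[K]_N) = \det (\matrix_(i, l) e l (q i) : 'M[K]_N).
Proof.
move=> low.
have /fin_all_exists [t tE] := fun l : 'I_N => low l.
pose L : 'M[K]_N := \matrix_(k, l) (if (k < l)%N then t l k else (k == l)%:R).
have -> : \matrix_(i, l) u l (q i) = (\matrix_(i, k) e k (q i)) *m L.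
  apply/matrixP => i l; rewrite !mxE -[LHS](subrK (e l (q i))) tE.
  rewrite (big_ord_widen N (fun k => t l k * e k (q i)) (ltnW (ltn_ord l))).
  rewrite [RHS](bigID (fun k : 'I_N => (k < l)%N)) /=; congr (_ + _).
    by apply: eq_bigr => k lt_kl; rewrite !mxE lt_kl mulrC.
  rewrite (bigD1 l) ?ltnn //= !mxE ltnn eqxx mulr1 big1 ?addr0 // => k.
  by case/andP=> /negPf nkl /negPf kl; rewrite !mxE nkl kl mulr0.
have L_trig : is_trig_mx L^T.
  apply/is_trig_mxP => i j lt_ij; rewrite !mxE (ltnNge j i) (ltnW lt_ij) /=.
  by rewrite -val_eqE /= gtn_eqF.
rewrite det_mulmx -[\det L]det_tr (det_trig L_trig) big1 ?mulr1 // => i _.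
by rewrite !mxE ltnn eqxx.
Qed.

End Unitriangular.

(** * Orthogonal characters as quotients of determinants in c_s *)

Section OrthogonalCharacters.
Variable K : fieldType.

(* With z = w^2, this is z^(s/2) + z^(-s/2). *)
Definition cs (s : nat) (w : K) : K := w ^+ s + w ^- s.

(** The product-to-sum formula for cosines; t <= s keeps the subtraction of natural numbers
    exact. *)
Lemma csM s t w : w != 0 -> (t <= s)%N ->
  cs t w * cs s w = cs (s + t) w + cs (s - t) w.
Proof.
move=> w_neq0 le_ts; rewrite -{1 2}(subnKC le_ts) /cs !exprD.
by field; rewrite !expf_neq0.
Qed.

Lemma cs0 w : cs 0 w = 2.
Proof. by rewrite /cs expr0 invr1. Qed.

(** Characters list their exponents in decreasing order, the matrices here in increasing order. Only
    the fact that the sign depends on N alone matters, as it cancels in the quotient. *)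
Lemma det_rev_col N (A : 'M[K]_N) :
  \det (\matrix_(i, j) A i (rev_ord j)) = (-1) ^+ perm (@rev_ord_inj N) * \det A.
Proof.
rewrite -odd_permV -det_perm mulrC -det_mulmx -col_permE; congr (\det _).
by apply/matrixP => i j; rewrite !mxE permE.
Qed.

Definition weyl_den N (w : 'rV[K]_N) : K := vprod (map_mx (cs 2) w).

(** The power c_2^l is c_{2l} plus lower terms for l > 0, so the matrix reduces to a Vandermonde
    matrix in c_2. The factor 2 comes from the column c_0 = 2. *)
Lemma det_weyl N (w : 'rV[K]_N) :
    (0 < N)%N -> (forall i, w 0 i != 0) ->
  \det (\matrix_(i, l) cs (2 * l) (w 0 i) : 'M[K]_N) = 2 * weyl_den w.
Proof.
move=> N_gt0 w_neq0.
(* The first column is taken as 1 rather than c_0 = 2, so that the change of columns is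
   unitriangular. *)
pose e (l : nat) (i : 'I_N) := if l == 0 then 1 else cs (2 * l) (w 0 i).
pose u (l : nat) (i : 'I_N) := cs 2 (w 0 i) ^+ l.
have low l : lower e l (fun i => u l i - e l i).
  apply: (@lower_rec _ _ e u 1 (fun i => cs 2 (w 0 i))) => // {}l.
  - case: l => // _; apply: (lower_ext _ (lower0 e 0)) => i.
    by rewrite /u /e expr0 subrr.
  - by move=> i; rewrite /u addn1 exprS.
  - case: l => [|[|l]].
    + apply: (lower_ext _ (lower0 e _)) => i.
      by rewrite /e mulr1 subrr.
    + have /(lowerZ 2) : lower e (1 + 1) (e 0) by exact: lower_e.
      apply: lower_ext => i.
      by rewrite /e /= csM // cs0 mulr1 addrC addKr.
    + have : lower e (l.+2 + 1) (e l.+1) by apply: lower_e; lia.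
      have le2 : (2 <= 2 * l.+2)%N by lia.
      apply: lower_ext => i; rewrite /e /= (csM (w_neq0 i) le2).
      have -> : (2 * (l.+2 + 1) = 2 * l.+2 + 2)%N by lia.
      have -> : (2 * l.+1 = 2 * l.+2 - 2)%N by lia.
      by rewrite addrC addKr.
have -> : \matrix_(i, l) cs (2 * l) (w 0 i) =
    (\matrix_(i, l) e l i : 'M[K]_N) *m diag_mx (\row_(l < N) (if l == 0 :> nat then 2 else 1)).
  rewrite mul_mx_diag; apply/matrixP => i l; rewrite !mxE /e.
  by case: ifP => [/eqP ->|_]; rewrite ?muln0 ?cs0 ?mul1r ?mulr1.
rewrite det_mulmx det_diag -(det_lower id low) mulrC; congr (_ * _).
  rewrite (bigD1 (Ordinal N_gt0)) //= mxE big1 ?mulr1 // => i i_neq0.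
  by rewrite mxE ifN.
by rewrite /weyl_den -det_vdm; congr (\det _); apply/matrixP => i l; rewrite !mxE.
Qed.

Lemma halfpowE (w : K) (r : rat) (m : nat) : 2 * r = m%:R ->
  halfpow w r + halfpow w (- r) = cs m w.
Proof.
move=> rE; rewrite /halfpow mulrN rE.
by rewrite -[m%:R]/(m%:Z%:~R) -rmorphN !intrKfloor -exprnN -exprnP.
Qed.

(** Here [s l] is twice the exponent in column [l] counted from the right, because z = w^2. The
    reversal signs of numerator and denominator cancel, and the factor 1/2 absorbs the 2 of
    [det_weyl]. *)
Lemma OtildeE N (lambda : 'I_N -> rat) (w : 'rV[K]_N) (s : nat -> nat) :
    2 != 0 :> K -> (0 < N)%N -> (forall i, w 0 i != 0) ->
    (forall j : 'I_N, 2 * (lambda j + (N - j.+1)%:R) = (s (N - j.+1)%N)%:R) ->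
  Otilde lambda w
  = \det (\matrix_(i, l) cs (s l) (w 0 i) : 'M[K]_N) / weyl_den w.
Proof.
move=> two_neq0 N_gt0 w_neq0 sE; rewrite /Otilde.
have rev (f : 'I_N -> rat) (g : nat -> nat) :
    (forall j : 'I_N, 2 * f j = (g (N - j.+1)%N)%:R) ->
    \det (\matrix_(i, j) (halfpow (w 0 i) (f j) + halfpow (w 0 i) (- f j)))
    = (-1) ^+ perm (@rev_ord_inj N)
      * \det (\matrix_(i, l) cs (g l) (w 0 i) : 'M[K]_N).
  move=> fg; rewrite -det_rev_col; congr (\det _); apply/matrixP => i j.
  by rewrite !mxE (halfpowE _ (fg j)).
rewrite (rev _ _ sE) (rev _ (fun l => 2 * l)%N) => [|j]; last by rewrite natrM.
rewrite det_weyl // mulrCA mulKf //.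
by rewrite -mulf_div divff ?mul1r // signr_eq0.
Qed.

End OrthogonalCharacters.

(** * The entries of the merged decreasing sequences *)

Lemma descending_bound (d : nat) (r : rat) (m : nat) : (0 < d)%N ->
    (forall k, (m <= k)%N -> r < (d * k)%:R) ->
  descending d r = [seq t <- [seq r - (d * k)%:R | k <- iota 0 m] | 0 <= t].
Proof.
move=> d_gt0.
pose f m := [seq t <- [seq r - (d * k)%:R | k <- iota 0 m] | 0 <= t].
(* Lengthening a sufficient range adds only negative terms, which the filter removes; hence any two
   sufficient ranges give the same sequence. *)
have ext (m1 m2 : nat) : (forall k, (m1 <= k)%N -> r < (d * k)%:R) ->
    (m1 <= m2)%N -> f m2 = f m1.
  move=> m1P le_m; rewrite -(subnKC le_m) /f iotaD map_cat filter_cat add0n.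
  rewrite -[RHS]cats0; congr (_ ++ _); apply/eqP; rewrite -[_ == _]negbK -has_filter.
  apply/negP => /hasP [t /mapP [k]]; rewrite mem_iota => /andP [m1k _] -> {t}.
  by rewrite subr_ge0 leNgt m1P.
move=> mP; change (f (Num.truncn r).+1 = f m).
have truncP k : ((Num.truncn r).+1 <= k)%N -> r < (d * k)%:R.
  move=> le_k; apply: (lt_le_trans (truncnS_gt r)).
  by rewrite ler_nat (leq_trans le_k) // leq_pmull.
by case/orP: (leq_total m (Num.truncn r).+1) => [/(ext _ _ mP)|/(ext _ _ truncP)].
Qed.

Lemma descendingE (d : nat) (r : rat) : (0 < d)%N ->
  descending d r = if 0 <= r then r :: descending d (r - d%:R) else [::].
Proof.
move=> d_gt0; case: ifP => [r_ge0|/negbT]; last first.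
  rewrite -ltNge => r_lt0; rewrite (@descending_bound d r 0) // => k _.
  exact: (lt_le_trans r_lt0).
rewrite (@descending_bound d (r - d%:R) (Num.truncn r)) // => [|k le_k].
  rewrite /descending /= muln0 subr0 r_ge0; congr (_ :: filter _ _).
  rewrite (iotaDl 1 0) -map_comp; apply: eq_map => k /=.
  by rewrite mulnDr natrD muln1 opprD addrA.
have : r < (Num.truncn r).+1%:R by rewrite truncnS_gt.
rewrite ltrBlDr -natrD -mulnSr => /lt_le_trans; apply.
by rewrite ler_nat (leq_trans (leq_pmull _ d_gt0)) // leq_pmul2l.
Qed.

(** Both sides are sorted and are permutations of each other. Exchanging [s] and [t] on the right is
    harmless, and suits an induction that takes entries from the two sequences in turn. *)
Lemma merge_desc_cons (r : rat) (s t : seq rat) :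
  all (fun v => v <= r) (s ++ t) -> merge_desc (r :: s) t = r :: merge_desc t s.
Proof.
move=> /allP max_r.
have tot : total (fun u v : rat => v <= u) by move=> u v; exact: le_total.
have trans : transitive (fun u v : rat => v <= u).
  by move=> u v w vu /le_trans; apply.
have anti : antisymmetric (fun u v : rat => v <= u).
  by move=> u v /andP [vu uv]; apply/eqP; rewrite eq_le uv vu.
apply: (sorted_eq trans anti); rewrite ?sort_sorted //.
  rewrite /= path_sortedE // sort_sorted // andbT; apply/allP => v.
  by rewrite mem_sort mem_cat orbC -mem_cat; exact: max_r.
by rewrite perm_sort /= perm_cons perm_sym perm_sort perm_catC.
Qed.

Lemma descending_le (d : nat) (r : rat) : all (fun v => v <= r) (descending d r).
Proof.
apply/allP => v; rewrite mem_filter => /andP [_ /mapP [k _ ->]].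
by rewrite lerBlDr lerDl.
Qed.

(* Removing the maximum r replaces the pair (r, s) by (s, r - d), which satisfies
   the same inequalities. *)
Lemma nth_merge_descending (d : nat) (r s : rat) (j : nat) :
    (0 < d)%N -> r - d%:R <= s <= r ->
    0 <= (if odd j then s else r) - (d * j./2)%:R ->
  nth 0 (merge_desc (descending d r) (descending d s)) j
  = (if odd j then s else r) - (d * j./2)%:R.
Proof.
move=> d_gt0; elim: j r s => [|j IHj] r s /andP [rs sr] v_ge0.
  rewrite /= muln0 subr0 in v_ge0 *.
  rewrite descendingE // v_ge0 merge_desc_cons //.
  rewrite all_cat; apply/andP; split; apply/allP => v.
    by move/(allP (descending_le _ _))/le_trans; apply; rewrite gerBl.
  by move/(allP (descending_le _ _))/le_trans; apply.
have vE : (if odd j.+1 then s else r) - (d * j.+1./2)%:R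
        = (if odd j then r - d%:R else s) - (d * j./2)%:R.
  rewrite /= uphalf_half; case: (odd j) => //=.
  by rewrite mulnDr muln1 natrD opprD addrA.
have r_ge0 : 0 <= r.
  apply: (le_trans v_ge0); rewrite lerBlDr.
  by apply: (@le_trans _ _ r); [case: ifP | rewrite lerDl].
rewrite vE in v_ge0 *; rewrite descendingE // r_ge0 merge_desc_cons /=.
  by apply: IHj => //; rewrite lerB // gerBl.
rewrite all_cat; apply/andP; split; apply/allP => v.
  by move/(allP (descending_le _ _))/le_trans; apply; rewrite gerBl.
by move/(allP (descending_le _ _))/le_trans; apply.
Qed.

(** * Reduction of A_VH to a determinant in X and Y *)

Section SigmaIdentities.
Variable K : fieldType.
Implicit Types a x y t : K.

(** Over a single denominator, the non-vanishing of a sigma becomes that of u^2 - v^2, the form of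
    the side conditions left by [field]. *)
Lemma sigma_div t u v : t = u / v -> u != 0 -> v != 0 ->
  sigma t = (u ^+ 2 - v ^+ 2) / (u * v).
Proof. by move=> -> u0 v0; rewrite /sigma; field; rewrite ?u0 ?v0. Qed.

Definition sigma4 a x y : K :=
  sigma (a * x / y) * sigma (a * y / x) * sigma (a * x * y) * sigma (a / (x * y)).

Lemma sigma4E a x y : a != 0 -> x != 0 -> y != 0 ->
  sigma4 a x y = cs 2 a ^+ 2 - cs 2 a * cs 2 x * cs 2 y + cs 2 x ^+ 2
                 + cs 2 y ^+ 2 - 4.
Proof.
by move=> a0 x0 y0; rewrite /sigma4 /sigma /cs; field; rewrite y0 x0.
Qed.

Lemma MUU_entry a x y : a != 0 -> x != 0 -> y != 0 -> sigma4 a x y != 0 ->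
  sigma (a / y) * sigma (a * x) / sigma (a * x / y)
  - sigma (a / y) * sigma (a / x) / sigma (a / (x * y))
  - sigma (a * y) * sigma (a * x) / sigma (a * x * y)
  + sigma (a * y) * sigma (a / x) / sigma (a * y / x)
  = sigma a * sigma (x ^+ 2) * sigma (y ^+ 2)
    * ((cs 2 x + cs 2 y - cs 2 a - 2) / sigma4 a x y).
Proof.
move=> a0 x0 y0; rewrite /sigma4 !mulf_eq0 !negb_or -!andbA.
have ax0 : a * x != 0 by rewrite mulf_neq0.
have ay0 : a * y != 0 by rewrite mulf_neq0.
have axy0 : a * x * y != 0 by rewrite mulf_neq0.
have xy0 : x * y != 0 by rewrite mulf_neq0.
rewrite (sigma_div (t := a * x / y) erefl) //.
rewrite (sigma_div (t := a * y / x) erefl) //.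
rewrite (sigma_div (t := a / (x * y)) erefl) //.
rewrite (sigma_div (t := a * x * y) (esym (divr1 _))) ?oner_eq0 //.
rewrite !mulf_eq0 !invr_eq0 !negb_or !mulf_eq0 !negb_or => /and4P [].
move=> /andP [d1 _] /andP [d2 _] /andP [d3 _] /andP [d4 _].
by move: d3; rewrite expr1n => d3; rewrite /sigma /cs; field; rewrite ?a0 ?x0 ?y0 ?d1 ?d2 ?d3 ?d4.
Qed.

Lemma sigma_sqr a : a != 0 -> sigma a ^+ 2 = cs 2 a - 2.
Proof. by move=> a0; rewrite /sigma /cs; field. Qed.

(** For i < j the four sigmas multiply to (X_i - X_j)(Y_i - Y_j), where the signs relative to the
    Vandermonde products cancel. For i = j, sigma(x^-2) = -sigma(x^2) gives the sign (-1)^n. *)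
Lemma FV_den n (x y : 'rV[K]_n) :
    (forall i, x 0 i != 0) -> (forall i, y 0 i != 0) ->
  (\prod_(i < n) \prod_(j < n | (i < j)%N)
     (sigma (x 0 j / x 0 i) * sigma (y 0 i / y 0 j)))
  * (\prod_(i < n) \prod_(j < n | (i <= j)%N)
       (sigma (1 / (x 0 i * x 0 j)) * sigma (y 0 i * y 0 j)))
  = (-1) ^+ n * weyl_den x * weyl_den y
    * \prod_(i < n) (sigma (x 0 i ^+ 2) * sigma (y 0 i ^+ 2)).
Proof.
move=> x0 y0.
have le_split (i : 'I_n) (F : 'I_n -> K) : \prod_(j < n | (i <= j)%N) F j
    = F i * \prod_(j < n | (i < j)%N) F j.
  rewrite (bigD1 i) //=; congr (_ * _); apply: eq_bigl => j.
  by rewrite ltn_neqAle andbC eq_sym.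
under [X in _ * X]eq_bigr do rewrite le_split.
have diag_part :
    \prod_(i < n) (sigma (1 / (x 0 i * x 0 i)) * sigma (y 0 i * y 0 i))
    = (-1) ^+ n * \prod_(i < n) (sigma (x 0 i ^+ 2) * sigma (y 0 i ^+ 2)).
  have -> : (-1) ^+ n = \prod_(i < n) (-1) :> K by rewrite prodr_const card_ord.
  rewrite -big_split; apply: eq_bigr => i _ /=.
  by rewrite /sigma; field; rewrite y0 x0 oner_neq0.
have offdiag_part :
    (\prod_(i < n) \prod_(j < n | (i < j)%N)
       (sigma (x 0 j / x 0 i) * sigma (y 0 i / y 0 j)))
    * (\prod_(i < n) \prod_(j < n | (i < j)%N)
         (sigma (1 / (x 0 i * x 0 j)) * sigma (y 0 i * y 0 j)))
    = weyl_den x * weyl_den y.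
  rewrite /weyl_den /vprod -!big_split; apply: eq_bigr => i _ /=.
  rewrite -!big_split; apply: eq_bigr => j _ /=; rewrite !mxE /sigma /cs.
  by field; rewrite !y0 !x0 oner_neq0.
rewrite [X in _ * X = _]big_split /= diag_part mulrCA offdiag_part.
by rewrite -!mulrA; congr (_ * _); rewrite mulrC mulrA.
Qed.

(** The factors sigma(x_i^2) and sigma(y_j^2) taken out of the rows and columns of M_UU cancel the
    diagonal factors of F_V. The n factors sigma(a) reduce the prefactor to sigma(a)^(-2n^2). *)
Lemma AVH2E n (x y : 'rV[K]_n) a :
    a != 0 -> sigma a != 0 ->
    (forall i, x 0 i != 0) -> (forall i, y 0 i != 0) ->
    (forall i, sigma (x 0 i ^+ 2) != 0) -> (forall i, sigma (y 0 i ^+ 2) != 0) ->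
    (forall i j, sigma4 a (x 0 i) (y 0 j) != 0) ->
  AVH2 x y a
  = (2 - cs 2 a) ^- (n ^ 2)
    * ((\prod_(i < n) \prod_(j < n) sigma4 a (x 0 i) (y 0 j))
       * \det (\matrix_(i, j) ((cs 2 (x 0 i) + cs 2 (y 0 j) - cs 2 a - 2)
                               / sigma4 a (x 0 i) (y 0 j)) : 'M[K]_n))
    / (weyl_den x * weyl_den y).
Proof.
move=> a0 sa0 x0 y0 sx0 sy0 s40; rewrite /AVH2 /FV FV_den //.
set M := \matrix_(i, j) _.
have -> : MUU x y a a a = diag_mx (\row_i (sigma a * sigma (x 0 i ^+ 2))) *m M
                          *m diag_mx (\row_i sigma (y 0 i ^+ 2)).
  rewrite mul_mx_diag mul_diag_mx; apply/matrixP => i j.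
  by rewrite !mxE /= MUU_entry // mulrAC.
rewrite !det_mulmx !det_diag.
under [X in _ * (X * _ * _)]eq_bigr do rewrite mxE.
under [X in _ * (_ * _ * X)]eq_bigr do rewrite mxE.
rewrite !big_split /= prodr_const card_ord.
have -> : 2 - cs 2 a = - sigma a ^+ 2 by rewrite sigma_sqr // opprB.
(* As n^2 and n have the same parity, this sign cancels the one of [FV_den]. *)
have -> : (- sigma a ^+ 2) ^+ (n ^ 2) = (-1) ^+ n * sigma a ^+ (2 * n ^ 2).
  by rewrite [LHS]exprNn -[(_ ^+ 2) ^+ _]exprM -[(-1) ^+ (n ^ 2)]signr_odd oddX /= signr_odd.
have px0 : \prod_(i < n) sigma (x 0 i ^+ 2) != 0 by apply/prodf_neq0.
have py0 : \prod_(i < n) sigma (y 0 i ^+ 2) != 0 by apply/prodf_neq0.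
rewrite -/(sigma4 _ _ _) exprD; set P := \prod_(i < n) \prod_(j < n) _.
have e0 : (-1) ^+ n != 0 :> K by rewrite signr_eq0.
move: (expf_neq0 n sa0) (expf_neq0 (2 * n ^ 2) sa0) e0 px0 py0.
move: (sigma a ^+ n) (sigma a ^+ (2 * n ^ 2)) ((-1) ^+ n).
move: (\prod_(i < n) sigma (x 0 i ^+ 2)) (\prod_(i < n) sigma (y 0 i ^+ 2)).
move=> px py sn s2n e sn0 s2n0 e0 px0 py0.
rewrite !invfM; move: (weyl_den x)^-1 (weyl_den y)^-1 e^-1 s2n^-1 => wx wy e' s'.
by move: (\det M) => dM; field; rewrite py0 px0.
Qed.

End SigmaIdentities.

(** * The determinants in c_s that arise at zeta_6 and zeta_8 *)

Section SpecialValues.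
Variable K : fieldType.

Lemma det_scale_rows N (c : 'I_N -> K) (A : 'M[K]_N) :
  \det (\matrix_(i, l) (c i * A i l)) = (\prod_i c i) * \det A.
Proof.
have -> : \matrix_(i, l) (c i * A i l) = diag_mx (\row_i c i) *m A.
  by rewrite mul_diag_mx; apply/matrixP => i l; rewrite !mxE.
by rewrite det_mulmx det_diag; congr (_ * _); apply: eq_bigr => i _; rewrite mxE.
Qed.

Lemma cs2_sqr (w : K) : w != 0 -> cs 2 w ^+ 2 = cs 4 w + 2.
Proof. by move=> w0; rewrite expr2 csM // cs0. Qed.

Lemma cs3E (w : K) : w != 0 -> cs 1 w * (cs 2 w - 1) = cs 3 w.
Proof. by move=> w0; rewrite /cs; field. Qed.

Lemma cs5E (w : K) : w != 0 -> cs 1 w * (cs 2 w ^+ 2 - cs 2 w - 1) = cs 5 w.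
Proof. by move=> w0; rewrite /cs; field. Qed.

Lemma cs6E (w : K) : w != 0 -> cs 6 w = cs 2 w ^+ 3 - 3 * cs 2 w.
Proof. by move=> w0; rewrite /cs; field. Qed.

(** Scaling row i by c_1(w_i) turns the columns into c_6^k c_1 and c_6^k c_5. The exponents 1, 5, 7,
    11, ... are those congruent to 1 or -1 modulo 6, a set kept by s -> s + 6 and s -> |s - 6|. *)
Lemma det_interM_cs N (w : 'rV[K]_N) : (forall i, w 0 i != 0) ->
  (\prod_i cs 1 (w 0 i))
    * \det (interM N (map_mx (cs 6) w)
                     (map_mx (fun t => cs 2 t ^+ 2 - cs 2 t - 1) w))
  = \det (\matrix_(i, l) cs (3 * l + odd l).+1 (w 0 i) : 'M[K]_N).
Proof.
move=> w0; rewrite -det_scale_rows.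
pose u (l : nat) (i : 'I_N) :=
  cs 6 (w 0 i) ^+ l./2 * (if odd l then cs 5 (w 0 i) else cs 1 (w 0 i)).
pose e (l : nat) (i : 'I_N) := cs (3 * l + odd l).+1 (w 0 i).
rewrite -[RHS](@det_lower _ _ e u _ id); last first.
  apply: (@lower_rec _ _ e u 2 (fun i => cs 6 (w 0 i))) => // l.
  - case: l => [|[|]] // _; apply: (lower_ext _ (lower0 _ _)) => i;
      by rewrite /u /e expr0 mul1r subrr.
  - by move=> i; rewrite /u addn2 /= negbK exprS mulrA.
  - case: l => [|[|l]].
    (* Exponents below 6 are treated apart: c_6 c_1 = c_7 + c_5 here and c_6 c_5 = c_11 + c_1
       next. *)
    + have : lower e 2 (e 1) by exact: lower_e.
      apply: lower_ext => i; rewrite /e /= [cs 6 _ * _]mulrC csM //.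
      by rewrite addrC addKr.
    + have : lower e 3 (e 0) by exact: lower_e.
      apply: lower_ext => i; rewrite /e /= [cs 6 _ * _]mulrC csM //.
      by rewrite addrC addKr.
    + have : lower e (l.+2 + 2) (e l) by apply: lower_e; lia.
      have le6 : (6 <= (3 * l.+2 + odd l).+1)%N by lia.
      apply: lower_ext => i; rewrite /e /= !addn2 /= !negbK (csM (w0 i) le6).
      have -> : ((3 * l.+4 + odd l).+1 = (3 * l.+2 + odd l).+1 + 6)%N by lia.
      have -> : ((3 * l + odd l).+1 = (3 * l.+2 + odd l).+1 - 6)%N by lia.
      by rewrite addrC addKr.
congr (\det _); apply/matrixP => i l; rewrite !mxE /u mulrCA; congr (_ * _).
by case: (odd l); rewrite ?mulr1 // cs5E.
Qed.

(** The exponents are 1, 7, 9, 15, ... for [false] and 3, 5, 11, 13, ... for [true], that is 1 or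
    -1, resp. 3 or -3, modulo 8. Each class is kept by multiplication by c_4^2 = c_8 + 2, hence the
    recursion in steps of two. *)
Lemma det_parM_cs N (b : bool) (w : 'rV[K]_N) : (forall i, w 0 i != 0) ->
  (\prod_i cs 1 (w 0 i))
    * \det (parM b (map_mx (cs 4) w) (map_mx (fun t => cs 2 t - 1) w))
  = \det (\matrix_(i, l) cs (4 * l + (if odd l (+) b then 3 else 1)) (w 0 i)
          : 'M[K]_N).
Proof.
move=> w0; rewrite -det_scale_rows.
pose u (l : nat) (i : 'I_N) :=
  cs 4 (w 0 i) ^+ l * (if odd l (+) b then cs 3 (w 0 i) else cs 1 (w 0 i)).
pose e (l : nat) (i : 'I_N) := cs (4 * l + (if odd l (+) b then 3 else 1)) (w 0 i).
rewrite -[RHS](@det_lower _ _ e u _ id); last first.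
  apply: (@lower_rec _ _ e u 2 (fun i => cs 4 (w 0 i) ^+ 2)) => // l.
  - case: l => [|[|]] // _.
      apply: (lower_ext _ (lower0 _ _)) => i.
      by rewrite /u /e expr0 mul1r muln0 add0n /=; case: (b); rewrite subrr.
    (* This is c_4 c_3 = c_7 + c_1 or c_4 c_1 = c_5 + c_3, according to [b]. *)
    have : lower e 1 (e 0) by exact: lower_e.
    apply: lower_ext => i; rewrite /u /e expr1 /=.
    by case: (b); rewrite /= [cs 4 _ * _]mulrC csM // addrC addKr.
  - by move=> i; rewrite /u addn2 /= negbK !exprS; ring.
  - have sq i : cs 4 (w 0 i) ^+ 2 = cs 8 (w 0 i) + 2 by rewrite expr2 csM // cs0.
    have low2 : lower e (l + 2) (fun i => 2 * e l i).
      by apply: lowerZ; apply: lower_e; lia.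
    case: l low2 => [|[|l]] low2.
    + have /(lowerD low2) : lower e (0 + 2) (e 1) by exact: lower_e.
      apply: lower_ext => i; rewrite /e sq (mulrDl (cs 8 _)) [cs 8 _ * _]mulrC.
      by rewrite csM; [case: (b) => /=; ring | | case: (b)].
    + have /(lowerD low2) : lower e (1 + 2) (e 0) by exact: lower_e.
      apply: lower_ext => i; rewrite /e sq (mulrDl (cs 8 _)) [cs 8 _ * _]mulrC.
      by rewrite csM; [case: (b) => /=; ring | | case: (b)].
    + have /(lowerD low2) : lower e (l.+2 + 2) (e l) by apply: lower_e; lia.
      pose c : nat := if odd l (+) b then 3 else 1.
      have le8 : (8 <= 4 * l.+2 + c)%N by lia.
      apply: lower_ext => i; rewrite /e sq /= !addn2 /= !negbK -/c.
      rewrite (mulrDl (cs 8 _)) (csM (w0 i) le8).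
      have -> : (4 * l.+4 + c = 4 * l.+2 + c + 8)%N by lia.
      have -> : (4 * l + c = 4 * l.+2 + c - 8)%N by lia.
      by ring.
congr (\det _); apply/matrixP => i l; rewrite !mxE /u mulrCA; congr (_ * _).
by case: (_ (+) _); rewrite ?mulr1 // cs3E.
Qed.

End SpecialValues.

(** * The three evaluations over a field, for generic variables *)

Section SpecialParameters.
Variable K : fieldType.

(** Squares in the third condition separate X_i from both X_j and -X_j: at zeta_4 the sums X + Y are
    inverted, and at zeta_8 the nodes c_4 = X^2 - 2 must be distinct. *)
Definition generic N (a : K) (w : 'rV[K]_N) : Prop :=
  [/\ forall i, w 0 i != 0,
      forall i, sigma (w 0 i ^+ 2) != 0,
      forall i j, i != j -> cs 2 (w 0 i) ^+ 2 != cs 2 (w 0 j) ^+ 2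
    & forall i j, sigma4 a (w 0 i) (w 0 j) != 0].

Lemma generic_cs2 N a (w : 'rV[K]_N) i j : generic a w -> i != j ->
  cs 2 (w 0 i) != cs 2 (w 0 j).
Proof. by case=> _ _ cs2_inj _ /cs2_inj; apply: contra_neq => ->. Qed.

Lemma generic_cs1 N a (w : 'rV[K]_N) i : generic a w -> cs 1 (w 0 i) != 0.
Proof.
case=> w0 sw0 _ _; apply: contraNneq (sw0 i) => cs1w.
have -> : sigma (w 0 i ^+ 2) = cs 1 (w 0 i) * sigma (w 0 i).
  by have := w0 i; rewrite /cs /sigma => wi0; field.
by rewrite cs1w mul0r.
Qed.

Lemma generic_weyl N a (w : 'rV[K]_N) : generic a w -> weyl_den w != 0.
Proof.
by move=> gw; apply: vprod_neq0 => i j /(generic_cs2 gw); rewrite !mxE.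
Qed.

Lemma generic_row_mx n a (x y : 'rV[K]_n) : generic a (row_mx x y) ->
  [/\ generic a x, generic a y,
      forall i j, cs 2 (x 0 i) ^+ 2 != cs 2 (y 0 j) ^+ 2
    & forall i j, sigma4 a (x 0 i) (y 0 j) != 0].
Proof.
case=> w0 sw0 cs2_inj s40; split; first split.
- by move=> i; have := w0 (lshift n i); rewrite row_mxEl.
- by move=> i; have := sw0 (lshift n i); rewrite row_mxEl.
- move=> i j ij; have := cs2_inj (lshift n i) (lshift n j); rewrite !row_mxEl.
  by apply; rewrite (inj_eq (@lshift_inj _ _)).
- by move=> i j; have := s40 (lshift n i) (lshift n j); rewrite !row_mxEl.
- split.
  + by move=> i; have := w0 (rshift n i); rewrite row_mxEr.
  + by move=> i; have := sw0 (rshift n i); rewrite row_mxEr.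
  + move=> i j ij; have := cs2_inj (rshift n i) (rshift n j); rewrite !row_mxEr.
    by apply; rewrite (inj_eq (@rshift_inj _ _)).
  + by move=> i j; have := s40 (rshift n i) (rshift n j); rewrite !row_mxEr.
- move=> i j; have := cs2_inj (lshift n i) (rshift n j).
  by rewrite row_mxEl row_mxEr; apply; rewrite eq_lrshift.
- by move=> i j; have := s40 (lshift n i) (rshift n j); rewrite row_mxEl row_mxEr.
Qed.

Lemma sigma_neq0 (a : K) : a != 0 -> cs 2 a != 2 -> sigma a != 0.
Proof.
by move=> a0; apply: contra_neq => sa0; apply/eqP; rewrite -subr_eq0 -sigma_sqr // sa0 expr0n.
Qed.

(* Over the rational functions, C is the set of constants. *)
Lemma genericP (C : K -> Prop) N (a : K) (w : 'rV[K]_N) :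
    C 1 -> C (-1) -> C (a ^+ 2) -> C (a ^- 2) ->
    a != 0 -> sigma a != 0 -> (forall i, w 0 i != 0) ->
    (forall b i j, C b -> i != j -> b * w 0 i ^+ 2 - w 0 j ^+ 2 != 0) ->
    (forall b i j, C b -> b * w 0 i ^+ 2 * w 0 j ^+ 2 - 1 != 0) ->
  generic a w.
Proof.
move=> C1 CN1 Ca2 CaN2 a0 sa0 w0 sqr_neq prod_neq.
split=> [i | i | i j ij | i j].
- exact: w0.
- have := prod_neq _ i i C1; have := w0 i; move: (w 0 i) => {w0 sqr_neq prod_neq}w w0.
  have -> : sigma (w ^+ 2) = (1 * w ^+ 2 * w ^+ 2 - 1) / w ^+ 2.
    by rewrite /sigma; field.
  by move=> nz; rewrite mulf_neq0 // invr_eq0 expf_neq0.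
- have := sqr_neq _ _ _ C1 ij; have := sqr_neq _ _ _ CN1 ij.
  have := prod_neq _ i j C1; have := prod_neq _ i j CN1; have := w0 i; have := w0 j.
  move: (w 0 i) (w 0 j) => {w0 sqr_neq prod_neq}w v v0 w0 p1 p2 p3 p4.
  rewrite -subr_eq0.
  have -> : cs 2 w ^+ 2 - cs 2 v ^+ 2
    = (-1 * w ^+ 2 * v ^+ 2 - 1) * (1 * w ^+ 2 * v ^+ 2 - 1)
      * (-1 * w ^+ 2 - v ^+ 2) * (1 * w ^+ 2 - v ^+ 2) / (w ^+ 4 * v ^+ 4).
    by rewrite /cs; field; rewrite v0 w0.
  by do ?[apply: mulf_neq0 => //]; rewrite invr_eq0 mulf_neq0 // expf_neq0.
- rewrite /sigma4 -mulrA mulf_neq0 //.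
    (* For i = j both factors are sigma(a). *)
    have [-> | ij] := eqVneq i j; first by rewrite mulfK // mulf_neq0.
    have ji : j != i by rewrite eq_sym.
    have := sqr_neq _ _ _ Ca2 ij; have := sqr_neq _ _ _ Ca2 ji.
    have := w0 i; have := w0 j.
    move: (w 0 i) (w 0 j) => {w0 sqr_neq prod_neq}w v v0 w0 p1 p2.
    have -> : sigma (a * w / v) * sigma (a * v / w)
      = (a ^+ 2 * v ^+ 2 - w ^+ 2) * (a ^+ 2 * w ^+ 2 - v ^+ 2)
        / (a ^+ 2 * w ^+ 2 * v ^+ 2).
      by rewrite /sigma; field; rewrite v0 w0.
    by do ?[apply: mulf_neq0 => //]; rewrite invr_eq0 !mulf_neq0 // expf_neq0.
  have := prod_neq _ i j Ca2; have := prod_neq _ i j CaN2.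
  have := w0 i; have := w0 j.
  move: (w 0 i) (w 0 j) => {w0 sqr_neq prod_neq}w v v0 w0 p1 p2.
  have -> : sigma (a * w * v) * sigma (a / (w * v))
    = (1 - a ^- 2 * w ^+ 2 * v ^+ 2) * (a ^+ 2 * w ^+ 2 * v ^+ 2 - 1)
      / (w ^+ 2 * v ^+ 2).
    by rewrite /sigma; field; rewrite v0 w0.
  rewrite -[1 - _]opprB; do ?[apply: mulf_neq0 => //]; first by rewrite oppr_eq0.
  by rewrite invr_eq0 mulf_neq0 // expf_neq0.
Qed.

(** For A = -2 the Cauchy determinant cancels all but one power of the product of the X_i + Y_j, and
    X + Y = (x^2 + y^2)(1 + x^2 y^2) / (x^2 y^2). *)
Lemma AVH2_order4 n (x y : 'rV[K]_n) a :
    2 != 0 :> K -> a != 0 -> cs 2 a = -2 -> generic a (row_mx x y) ->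
  AVH2 x y a
  = 2 ^- (2 * n ^ 2)
    * (\prod_(i < n) (x 0 i ^- (2 * n) * y 0 i ^- (2 * n)))
    * (\prod_(i < n) \prod_(j < n)
         ((x 0 i ^+ 2 + y 0 j ^+ 2) * (1 + x 0 i ^+ 2 * y 0 j ^+ 2))).
Proof.
move=> two0 a0 aE /generic_row_mx [gx gy xy s40].
have [[x0 sx0 _ _] [y0 sy0 _ _]] := (gx, gy).
have XY i j : cs 2 (x 0 i) + cs 2 (y 0 j) != 0.
  by apply: contra_neq (xy i j) => /eqP; rewrite addr_eq0 => /eqP ->; rewrite sqrrN.
have s4E i j : sigma4 a (x 0 i) (y 0 j) = (cs 2 (x 0 i) + cs 2 (y 0 j)) ^+ 2.
  by rewrite sigma4E // aE; ring.
have four : 2 - -2 = 2 ^+ 2 :> K by ring.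
have sa0 : sigma a != 0.
  by rewrite sigma_neq0 // aE eq_sym -subr_eq0 four expf_neq0.
rewrite AVH2E // aE.
under [X in _ * (X * _) / _]eq_bigr do under eq_bigr do rewrite s4E.
have -> : \matrix_(i, j) ((cs 2 (x 0 i) + cs 2 (y 0 j) - -2 - 2)
                            / sigma4 a (x 0 i) (y 0 j))
  = \matrix_(i, j) ((map_mx (cs 2) x) 0 i + (map_mx (cs 2) y) 0 j)^-1 :> 'M[K]_n.
  apply/matrixP => i j; rewrite !mxE s4E opprK addrK.
  by have := XY i j => nz; field.
have := @det_cauchy _ n (map_mx (cs 2) x) (map_mx (cs 2) y).
set D := \det _ => cauchy.
have prodXY : \prod_(i < n) \prod_(j < n) (cs 2 (x 0 i) + cs 2 (y 0 j)) * D
            = weyl_den x * weyl_den y.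
  rewrite -cauchy; first congr (_ * _).
  - by apply: eq_bigr => i _; apply: eq_bigr => j _; rewrite !mxE.
  - by move=> i j ij; rewrite !mxE (generic_cs2 gx).
  - by move=> i j; rewrite !mxE.
have prod2 : \prod_(i < n) \prod_(j < n) (cs 2 (x 0 i) + cs 2 (y 0 j)) ^+ 2
  = (\prod_(i < n) \prod_(j < n) (cs 2 (x 0 i) + cs 2 (y 0 j))) ^+ 2.
  by rewrite -prodrXl; apply: eq_bigr => i _; rewrite -prodrXl.
rewrite prod2.
have : weyl_den x * weyl_den y != 0.
  by rewrite mulf_neq0 ?(generic_weyl gx) ?(generic_weyl gy).
(* With V(X) V(Y) written as S D, the quotient to evaluate is S^2 D / (S D) = S. *)
rewrite -prodXY mulf_eq0 negb_or => /andP [S0 D0].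
rewrite four -exprM -mulrA -[in RHS]mulrA; congr (_ * _).
set S := \prod_(i < n) \prod_(j < n) _ in S0 *.
transitivity S; first by field; rewrite S0 D0.
rewrite /S.
have -> : \prod_(i < n) (x 0 i ^- (2 * n) * y 0 i ^- (2 * n))
        = \prod_(i < n) \prod_(j < n) (x 0 i ^- 2 * y 0 j ^- 2).
  rewrite big_split /=; under [RHS]eq_bigr do rewrite big_split /=.
  rewrite big_split /= [X in _ = _ * X]exchange_big /=.
  congr (_ * _); apply: eq_bigr => i _;
    by rewrite prodr_const card_ord exprVn -exprM.
rewrite -big_split; apply: eq_bigr => i _ /=; rewrite -big_split.
apply: eq_bigr => j _ /=; rewrite /cs; have := y0 j; have := x0 i => xi yj.
by field; rewrite yj.
Qed.

(** For A = -1, X + Y - A - 2 is the divided difference of f = c_2^2 - c_2 - 1 in the variable c_2,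
    and dividing by D replaces Y - X by c_6(y) - c_6(x). The product of the Y_j - X_i completes V(X)
    V(Y) to the denominator in 2n variables. *)
Lemma AVH2_order6 n (x y : 'rV[K]_n) a :
    3 != 0 :> K -> a != 0 -> cs 2 a = -1 ->
    generic a (row_mx x y) ->
  AVH2 x y a
  = 3 ^- (n ^ 2)
    / (\prod_(i < n) ((x 0 i + (x 0 i)^-1) * (y 0 i + (y 0 i)^-1)))
    * (\det (\matrix_(i, l) cs (3 * l + odd l).+1 (row_mx x y 0 i) : 'M[K]_(n + n))
       / weyl_den (row_mx x y)).
Proof.
move=> three0 a0 aE gw.
have [gx gy xy s40] := generic_row_mx gw.
have [[x0 sx0 _ _] [y0 sy0 _ _]] := (gx, gy).
have w0 : forall i, row_mx x y 0 i != 0 by case: gw.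
have cs6B u v : u != 0 -> v != 0 ->
    cs 6 v - cs 6 u = (cs 2 v - cs 2 u) * sigma4 a u v.
  by move=> u0 v0; rewrite sigma4E // aE !cs6E //; ring.
have XY i j : cs 2 (y 0 j) - cs 2 (x 0 i) != 0.
  by rewrite subr_eq0; apply: contra_neq (xy i j) => ->.
pose f (t : K) := cs 2 t ^+ 2 - cs 2 t - 1.
have := @det_interM K n (row_mx x y) (map_mx (cs 6) x) (map_mx (cs 6) y)
          (map_mx f x) (map_mx f y).
rewrite -!map_row_mx => interE.
rewrite -det_interM_cs // interE; last first.
- by move=> i j; rewrite !mxE -subr_eq0 cs6B // mulf_neq0.
- move=> i j ij; rewrite !mxE eq_sym -subr_eq0 cs6B // mulf_neq0 //.
    by rewrite subr_eq0 (generic_cs2 gx) // eq_sym.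
  by case: gx.
(* The auxiliary [t] of [det_interM] is the row of variables itself: equal squares would give equal
   values of c_2. *)
- move=> i j /(generic_cs2 gw); apply: contra_neq => ww.
  by rewrite /cs -!exprVn !expr2 -!expr2 exprVn ww exprVn.
have three : 2 - -1 = 3 :> K by ring.
have sa0 : sigma a != 0 by rewrite sigma_neq0 // aE eq_sym -subr_eq0 three.
rewrite AVH2E // aE three.
have -> : cauchyM (map_mx (cs 6) x) (map_mx (cs 6) y) (map_mx f x) (map_mx f y)
  = \matrix_(i, j) ((cs 2 (x 0 i) + cs 2 (y 0 j) - -1 - 2)
                     / sigma4 a (x 0 i) (y 0 j)).
  apply/matrixP => i j; rewrite !mxE cs6B // /f.
  by have := XY i j; have := s40 i j => s4nz xynz; field; rewrite s4nz.
set D := \det _.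
have -> : \prod_(i < n) \prod_(j < n) ((map_mx (cs 6) y) 0 j - (map_mx (cs 6) x) 0 i)
  = (\prod_(i < n) \prod_(j < n) (cs 2 (y 0 j) - cs 2 (x 0 i)))
    * (\prod_(i < n) \prod_(j < n) sigma4 a (x 0 i) (y 0 j)).
  rewrite -big_split; apply: eq_bigr => i _; rewrite -big_split.
  by apply: eq_bigr => j _; rewrite !mxE cs6B.
have weylE : weyl_den (row_mx x y) = weyl_den x * weyl_den y
    * \prod_(i < n) \prod_(j < n) (cs 2 (y 0 j) - cs 2 (x 0 i)).
  rewrite /weyl_den map_row_mx vprod_row_mx; congr (_ * _).
  by apply: eq_bigr => i _; apply: eq_bigr => j _; rewrite !mxE.
have := generic_weyl gw; rewrite weylE.
have -> : \prod_(i < n) ((x 0 i + (x 0 i)^-1) * (y 0 i + (y 0 i)^-1))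
        = \prod_i cs 1 (row_mx x y 0 i).
  rewrite big_split big_split_ord /=.
  by congr (_ * _); apply: eq_bigr => i _; rewrite ?row_mxEl ?row_mxEr /cs expr1.
have : \prod_i cs 1 (row_mx x y 0 i) != 0.
  by apply/prodf_neq0 => i _; apply: (generic_cs1 _ gw).
rewrite !mulf_eq0 !negb_or => c0 /andP [/andP [wx0 wy0] p0].
by move: (3 ^- (n ^ 2)) => t; field; rewrite p0 wy0 wx0.
Qed.

(** For A = 0 the numerator is f(x_i) + f(x_j) with f = c_2 - 1, and [det_parM] applies; its 2^n
    turns 2^(-n^2) into 2^(-n(n-1)). The value of [b] only fixes the order of the two factors. *)
Lemma AVH2_order8 n (b : bool) (x : 'rV[K]_n) a :
    (0 < n)%N -> 2 != 0 :> K -> a != 0 -> cs 2 a = 0 -> generic a x ->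
  AVH2 x x a
  = 2 ^- (n * (n - 1))
    / (\prod_(i < n) (x 0 i + (x 0 i)^-1) ^+ 2)
    * (\det (\matrix_(i, l) cs (4 * l + (if odd l (+) b then 3 else 1)) (x 0 i) : 'M[K]_n)
       / weyl_den x)
    * (\det (\matrix_(i, l) cs (4 * l + (if odd l (+) b then 1 else 3)) (x 0 i) : 'M[K]_n)
       / weyl_den x).
Proof.
move=> n_gt0 two0 a0 aE gx; have [x0 sx0 x2_inj s40] := gx.
have cs4D u v : u != 0 -> v != 0 -> cs 4 u + cs 4 v = sigma4 a u v.
  by move=> u0 v0; rewrite sigma4E // aE !cs2_sqr //; ring.
pose f (t : K) := cs 2 t - 1.
have := @det_parM K n (map_mx (cs 4) x) (map_mx f x) two0.
have -> : \matrix_(i, l) cs (4 * l + (if odd l (+) b then 1 else 3)) (x 0 i)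
  = \matrix_(i, l) cs (4 * l + (if odd l (+) ~~ b then 3 else 1)) (x 0 i) :> 'M_n.
  by apply/matrixP => i l; rewrite !mxE addbN; case: (_ (+) _).
have sa0 : sigma a != 0 by rewrite sigma_neq0 // aE eq_sym.
rewrite -!det_parM_cs // AVH2E // aE subr0.
have -> : \matrix_(i, j) ((cs 2 (x 0 i) + cs 2 (x 0 j) - 0 - 2)
                            / sigma4 a (x 0 i) (x 0 j))
  = \matrix_(i, j) (((map_mx f x) 0 i + (map_mx f x) 0 j)
                    / ((map_mx (cs 4) x) 0 i + (map_mx (cs 4) x) 0 j)) :> 'M[K]_n.
  by apply/matrixP => i j; rewrite !mxE cs4D // /f; congr (_ / _); ring.
have -> : \prod_(i < n) \prod_(j < n) sigma4 a (x 0 i) (x 0 j)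
  = \prod_(i < n) \prod_(j < n) ((map_mx (cs 4) x) 0 i + (map_mx (cs 4) x) 0 j).
  by apply: eq_bigr => i _; apply: eq_bigr => j _; rewrite !mxE cs4D.
move=> -> => [| i j ij | i j]; last by rewrite !mxE cs4D.
- have -> : \prod_(i < n) (x 0 i + (x 0 i)^-1) ^+ 2 = (\prod_i cs 1 (x 0 i)) ^+ 2.
    by rewrite -prodrXl; apply: eq_bigr => i _; rewrite /cs expr1.
  have : \prod_i cs 1 (x 0 i) != 0.
    by apply/prodf_neq0 => i _; apply: (generic_cs1 _ gx).
  have -> : 2 ^+ (n ^ 2) = 2 ^+ (n * (n - 1)) * 2 ^+ n :> K.
    by rewrite -exprD; congr (_ ^+ _); case: (n) n_gt0 => // m _; lia.
  have := expf_neq0 n two0; have := expf_neq0 (n * (n - 1)) two0.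
  have := generic_weyl gx.
  move: (2 ^+ n) (2 ^+ (n * (n - 1))) => t s w0 s0 t0 c0.
  by case: b => /=; field; rewrite w0 c0 s0.
- by rewrite !mxE; move: (x2_inj _ _ ij); rewrite !cs2_sqr // (inj_eq (addIr _)).
Qed.

End SpecialParameters.

(** * The roots of unity zeta_4, zeta_6 and zeta_8 *)

Section RootsOfUnity.
Variable R : realType.
Local Open Scope complex_scope.

Definition cis (t : R) : R[i] := cos t +i* sin t.

Lemma cisD s t : cis (s + t) = cis s * cis t.
Proof. by apply/eqP; rewrite eq_complex /= cosD sinD addrC eqxx /= addrC. Qed.

Lemma cis_pi : cis pi = -1.
Proof. by apply/eqP; rewrite eq_complex /= cospi sinpi oppr0 !eqxx. Qed.

Lemma cis_neq0 t : cis t != 0.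
Proof.
apply/eqP => /eqP; rewrite eq_complex /= => /andP [/eqP c0 /eqP s0].
by have := cos2Dsin2 t; rewrite c0 s0 !expr0n addr0 => /eqP; rewrite eq_sym oner_eq0.
Qed.

Lemma zeta_neq0 m : zeta R m != 0. Proof. exact: cis_neq0. Qed.

Lemma zeta4_sqr : zeta R 4 ^+ 2 = -1.
Proof. by rewrite expr2 -[zeta R 4]/(cis _) -cisD -cis_pi; congr cis; field. Qed.

Lemma zeta8_pow4 : zeta R 8 ^+ 4 = -1.
Proof.
rewrite -cis_pi (_ : pi = 2 * pi / 8%:R + 2 * pi / 8%:R
                          + (2 * pi / 8%:R + 2 * pi / 8%:R)); last by field.
by rewrite !cisD -!expr2 -exprM.
Qed.

Lemma zeta6_root : zeta R 6 ^+ 4 + zeta R 6 ^+ 2 + 1 = 0.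
Proof.
set z := zeta R 6.
have z3 : z ^+ 3 = -1.
  rewrite -cis_pi (_ : pi = 2 * pi / 6%:R + 2 * pi / 6%:R + 2 * pi / 6%:R); last by field.
  by rewrite !cisD exprSr expr2.
(* The imaginary part sin(pi/3) is positive, so z is not -1; then z^3 = -1 forces z^2 - z + 1 = 0, a
   factor of z^4 + z^2 + 1. *)
have zN1 : z + 1 != 0.
  apply/eqP => /eqP; rewrite eq_complex /= addr0 => /andP [_ /eqP sin0].
  have := @sin_gt0_pi R (2 * pi / 6%:R); rewrite sin0 ltxx.
  have := pi_gt0 R => pi0; move=> /(_ _)/negP; case; last by [].
  by apply/andP; split; lra.
have : (z + 1) * (z ^+ 2 - z + 1) = 0.
  by transitivity (z ^+ 3 + 1); [ring | rewrite z3 addNr].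
move/eqP; rewrite mulf_eq0 (negPf zN1) /= => /eqP z2.
by transitivity ((z ^+ 2 - z + 1) * (z ^+ 2 + z + 1)); [ring | rewrite z2 mul0r].
Qed.

End RootsOfUnity.

(** * Genericity of the indeterminates *)

Section Indeterminates.
Variables (R : realType) (n : nat).
Local Notation K := (ratfun R n).
Local Notation var k := (tofrac ('X_k : {mpoly R[i][n + n]})).
Implicit Types (c : R[i]) (k l : 'I_(n + n)).

Lemma cstM c d : cst n (c * d) = cst n c * cst n d.
Proof. by rewrite /cst !rmorphM. Qed.

Lemma cst1 : cst n (1 : R[i]) = 1.
Proof. by rewrite /cst !rmorph1. Qed.

Lemma cst_eq0 c : (cst n c == 0) = (c == 0).
Proof. by rewrite /cst tofrac_eq0 mpolyC_eq0. Qed.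

Lemma cstV c : c != 0 -> cst n c^-1 = (cst n c)^-1.
Proof.
move=> c0; have c0' : cst n c != 0 by rewrite cst_eq0.
by apply: (mulfI c0'); rewrite -cstM !mulfV // cst1.
Qed.

Lemma var_neq0 k : var k != 0 :> K.
Proof.
rewrite tofrac_eq0; apply/eqP => /(congr1 (meval (fun=> 1))).
by rewrite mevalXU meval0 => /eqP; rewrite oner_eq0.
Qed.

(** The value is -1 at the point whose only non-zero coordinate is X_l = 1. *)
Lemma var_sqr_neq c k l : k != l -> cst n c * var k ^+ 2 - var l ^+ 2 != 0 :> K.
Proof.
move=> kl; rewrite /cst -!rmorphXn -rmorphM -rmorphB tofrac_eq0.
apply/eqP => /(congr1 (meval (fun i => (i == l)%:R))).
rewrite mevalB mevalM mevalC !rmorphXn /= !mevalXU eqxx (negPf kl) meval0.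
by rewrite expr0n mulr0 sub0r expr1n => /eqP; rewrite oppr_eq0 oner_eq0.
Qed.

(** The value at the origin is -1. *)
Lemma var_prod_neq c k l : cst n c * var k ^+ 2 * var l ^+ 2 - 1 != 0 :> K.
Proof.
rewrite /cst -!rmorphXn -!rmorphM -tofrac1 -rmorphB tofrac_eq0.
apply/eqP => /(congr1 (meval (fun=> 0))).
rewrite mevalB 2!mevalM mevalC !rmorphXn /= !mevalXU meval0 meval1.
by rewrite expr0n !mulr0 sub0r => /eqP; rewrite oppr_eq0 oner_eq0.
Qed.

Lemma generic_vars N (s : 'I_N -> 'I_(n + n)) c :
    injective s -> c != 0 -> sigma (cst n c) != 0 ->
  generic (cst n c) (\row_i var (s i)).
Proof.
move=> s_inj c0 sc0.
apply: (@genericP K (fun b => exists d : R[i], b = cst n d)).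
- by exists 1; rewrite cst1.
- by exists (-1); rewrite /cst !rmorphN1.
- by exists (c ^+ 2); rewrite !expr2 cstM.
- by exists (c ^- 2); rewrite cstV ?expf_neq0 // !expr2 cstM.
- by rewrite cst_eq0.
- exact: sc0.
- by move=> i; rewrite mxE; exact: var_neq0.
- move=> _ i j [d ->] ij; rewrite !mxE; apply: var_sqr_neq.
  by rewrite (inj_eq s_inj).
- by move=> _ i j [d ->]; rewrite !mxE; exact: var_prod_neq.
Qed.

Lemma natr_ratfun_neq0 (m : nat) : (0 < m)%N -> m%:R != 0 :> K.
Proof.
move=> m0; have -> : m%:R = cst n m%:R :> K by rewrite /cst !rmorph_nat.
by rewrite cst_eq0 pnatr_eq0 -lt0n.
Qed.

End Indeterminates.

(** * The exponents of the three characters *)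

Section Exponents.
Variable n : nat.
Let h : rat := 1 / 2.

(** With l = 2n - j - 1, the indices j and l have opposite parities, and twice the j-th entry is l +
    2 for l odd and l + 1 for l even. *)
Lemma delta_exponent (j : 'I_(n + n)) :
  2 * (first_entries (n + n) (delta (n%:R + h) (n%:R - h)) j + (n + n - j.+1)%:R)
  = (3 * (n + n - j.+1) + odd (n + n - j.+1)).+1%:R.
Proof.
rewrite /first_entries /delta; move: (nat_of_ord j) (ltn_ord j) => {}j lt_j.
set k := j./2; set l := (n + n - j.+1)%N.
have jE : j = (odd j + 2 * k)%N by lia.
have odd_l : odd l = ~~ odd j by lia.
have k_le : (k.+1 <= n)%N by lia.
have nE : n%:R + n%:R = (odd j)%:R + 2 * k%:R + l%:R + 1 :> rat.
  by rewrite -natrM -!natrD -jE natr1; congr _%:R; lia.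
move: k_le; rewrite -(ler_nat rat) -natr1 => k_le.
rewrite nth_merge_descending -/k ?mul1n //; last by rewrite /h; case: ifP => _; lra.
  rewrite odd_l -[(_ + _).+1%:R]natr1 (natrD _ (3 * l)) (natrM _ 3) /h.
  by case: (odd j) nE => /= nE; lra.
by apply/andP; split; rewrite /h; lra.
Qed.

(** With l = n - j - 1, the j-th entry is l + 3/2 for j even and l + 1/2 for j odd. The parity of j
    is expressed through those of l and n, whence the dependence on [odd n]. *)
Lemma delta2_exponent_fst (j : 'I_n) :
  2 * (first_entries n (delta2 (n%:R + h) (n%:R - 3 / 2)) j + (n - j.+1)%:R)
  = (4 * (n - j.+1) + (if odd (n - j.+1) (+) odd n then 3 else 1))%:R.
Proof.
rewrite /first_entries /delta2; move: (nat_of_ord j) (ltn_ord j) => {}j lt_j.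
set k := j./2; set l := (n - j.+1)%N.
have jE : j = (odd j + 2 * k)%N by lia.
have odd_l : odd l (+) odd n = ~~ odd j by lia.
have k_le : (odd j + 2 * k + 1 <= n)%N by lia.
have nE : n%:R = (odd j)%:R + 2 * k%:R + l%:R + 1 :> rat.
  by rewrite -natrM -!natrD -jE natr1; congr _%:R; lia.
move: k_le; rewrite -(ler_nat rat) 2!natrD natrM => k_le.
rewrite nth_merge_descending -/k ?natrM //.
- rewrite odd_l natrD natrM /h.
  by case: (odd j) nE => /= nE; lra.
- by apply/andP; split; rewrite /h; lra.
- by rewrite /h; case: (odd j) k_le => /= k_le; lra.
Qed.

(** Here the j-th entry is l + 1/2 for j even and l + 3/2 for j odd, the opposite of the first
    character. *)
Lemma delta2_exponent_snd (j : 'I_n) :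
  2 * (first_entries n (delta2 (n%:R - h) (n%:R - h)) j + (n - j.+1)%:R)
  = (4 * (n - j.+1) + (if odd (n - j.+1) (+) odd n then 1 else 3))%:R.
Proof.
rewrite /first_entries /delta2; move: (nat_of_ord j) (ltn_ord j) => {}j lt_j.
set k := j./2; set l := (n - j.+1)%N.
have jE : j = (odd j + 2 * k)%N by lia.
have odd_l : odd l (+) odd n = ~~ odd j by lia.
have k_le : (odd j + 2 * k + 1 <= n)%N by lia.
have nE : n%:R = (odd j)%:R + 2 * k%:R + l%:R + 1 :> rat.
  by rewrite -natrM -!natrD -jE natr1; congr _%:R; lia.
move: k_le; rewrite -(ler_nat rat) 2!natrD natrM => k_le.
rewrite nth_merge_descending -/k ?natrM //.
- rewrite odd_l natrD natrM /h.
  by case: (odd j) nE => /= nE; lra.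
- by apply/andP; split; rewrite /h; lra.
- by rewrite /h; case: (odd j) k_le => /= k_le; lra.
Qed.

End Exponents.

(** * Specialisation to the indeterminates and the roots of unity *)

Lemma row_mx_vars (R : realType) (n : nat) :
  row_mx (xvar R n) (yvar R n) = \row_i tofrac 'X_i.
Proof.
by apply/rowP => i; case: (split_ordP i) => k ->;
   rewrite ?row_mxEl ?row_mxEr !mxE.
Qed.

Lemma cs2_eq (K : fieldType) (a A : K) :
  a != 0 -> a ^+ 4 + 1 = A * a ^+ 2 -> cs 2 a = A.
Proof.
move=> a0 aE; have -> : cs 2 a = (a ^+ 4 + 1) / a ^+ 2 by rewrite /cs; field.
by rewrite aE mulfK // expf_neq0.
Qed.

Theorem theorem2p3 (R : realType) (n : nat) (hn : (1 <= n)%N) :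
  let x := xvar R n in
  let y := yvar R n in
  let h : rat := 1 / 2 in
  [/\ AVH2 x y (cst n (zeta R 4))
      = 2 ^- (2 * n ^ 2)
        * (\prod_(i < n) (x 0 i ^- (2 * n) * y 0 i ^- (2 * n)))
        * (\prod_(i < n) \prod_(j < n)
             ((x 0 i ^+ 2 + y 0 j ^+ 2) * (1 + x 0 i ^+ 2 * y 0 j ^+ 2))),
      AVH2 x y (cst n (zeta R 6))
      = 3 ^- (n ^ 2)
        / (\prod_(i < n)
             ((x 0 i + (x 0 i)^-1) * (y 0 i + (y 0 i)^-1)))
        * Otilde (first_entries (n + n) (delta (n%:R + h) (n%:R - h)))
                 (row_mx x y)
    & AVH2 x x (cst n (zeta R 8))
      = 2 ^- (n * (n - 1))
        / (\prod_(i < n) (x 0 i + (x 0 i)^-1) ^+ 2)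
        * Otilde (first_entries n (delta2 (n%:R + h) (n%:R - 3 / 2))) x
        * Otilde (first_entries n (delta2 (n%:R - h) (n%:R - h))) x].
Proof.
move=> x y h.
have two0 := natr_ratfun_neq0 R n (isT : (0 < 2)%N).
have three0 := natr_ratfun_neq0 R n (isT : (0 < 3)%N).
have c0 m : cst n (zeta R m) != 0 by rewrite cst_eq0 zeta_neq0.
have sq m : cst n (zeta R m) ^+ 2 = cst n (zeta R m ^+ 2) by rewrite !expr2 cstM.
have pow4 m : cst n (zeta R m) ^+ 4 = cst n (zeta R m ^+ 4).
  by rewrite -[4%N]/(2 * 2)%N !exprM sq !expr2 !cstM.
have cstN1 : cst n (-1 : R[i]) = -1 by rewrite /cst !rmorphN1.
have a4 : cs 2 (cst n (zeta R 4)) = -2.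
  apply: (cs2_eq (c0 4)); rewrite sq (exprM _ 2 2) sq zeta4_sqr cstN1.
  by rewrite sqrrN expr1n mulrNN mulr1.
have a6 : cs 2 (cst n (zeta R 6)) = -1.
  apply: (cs2_eq (c0 6)); apply/eqP; rewrite mulN1r -subr_eq0 opprK addrAC sq pow4.
  by rewrite -cst1 /cst -!rmorphD zeta6_root !rmorph0.
have a8 : cs 2 (cst n (zeta R 8)) = 0.
  by apply: (cs2_eq (c0 8)); rewrite pow4 zeta8_pow4 cstN1 addNr mul0r.
have gen m : cs 2 (cst n (zeta R m)) != 2 -> generic (cst n (zeta R m)) (row_mx x y).
  move=> a2; rewrite row_mx_vars; apply: (@generic_vars R n _ id).
  - by [].
  - exact: zeta_neq0.
  - exact: (sigma_neq0 (c0 m)).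
have w0 i : row_mx x y 0 i != 0 by rewrite row_mx_vars mxE var_neq0.
have x0 i : x 0 i != 0 by have := w0 (lshift n i); rewrite row_mxEl.
have N2 m : cs 2 (cst n (zeta R m)) = - 2 -> cs 2 (cst n (zeta R m)) != 2.
  move=> ->; rewrite -subr_eq0 -opprD oppr_eq0 -natrD.
  exact: (natr_ratfun_neq0 R n (isT : (0 < 4)%N)).
have N1 m : cs 2 (cst n (zeta R m)) = - 1 -> cs 2 (cst n (zeta R m)) != 2.
  by move=> ->; rewrite -subr_eq0 -opprD oppr_eq0 addrC natr1.
have gx : generic (cst n (zeta R 8)) x.
  have a8N : cs 2 (cst n (zeta R 8)) != 2 by rewrite a8 eq_sym; exact: two0.
  by have [gx _ _ _] := generic_row_mx (gen 8 a8N); exact: gx.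
split.
- exact: (AVH2_order4 two0 (c0 4) a4 (gen 4 (N2 4 a4))).
- rewrite (AVH2_order6 three0 (c0 6) a6 (gen 6 (N1 6 a6))).
  congr (_ * _); symmetry.
  exact: (OtildeE (s := fun l => (3 * l + odd l).+1) two0 (ltn_addl n hn) w0
                  (@delta_exponent n)).
(* The choice [odd n] makes the order of the two factors agree with that of the two characters. *)
- rewrite (AVH2_order8 (odd n) hn two0 (c0 8) a8 gx).
  congr (_ * _ * _); symmetry.
  + exact: (OtildeE (s := fun l => 4 * l + (if odd l (+) odd n then 3 else 1))%N
                    two0 hn x0 (@delta2_exponent_fst n)).
  + exact: (OtildeE (s := fun l => 4 * l + (if odd l (+) odd n then 1 else 3))%N
                    two0 hn x0 (@delta2_exponent_snd n)).
Qed.
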